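(* Let $p=p_n$ possibly depend on $n$. Suppose that the following hold. (A1) The errors $\varepsilon_1,\dots,\varepsilon_n$ are independent and identically distributed, have $0$ as their $\tau$-th expectile (i.e. $\mathbb{E}[g_\tau(\varepsilon_i)]=0$), have a positive density which is continuous near $0$, and $\mathbb{E}(\varepsilon_i^4)<\infty$. (A2) There is a constant $C_0>0$ with $\max_{1\le i\le n}\|\mathbb{X}_i\|_\infty\le C_0$. (A3) There are constants $0<m_0\le M_0<\infty$ such that $m_0\le\delta_{\min}(\Upsilon_n)\le\delta_{\max}(\Upsilon_n)\le M_0$, where $\Upsilon_n=n^{-1}\sum_{i=1}^n\mathbb{X}_i\mathbb{X}_i^\top$. (A4) $p=O(n^c)$ with $c\in[0,1/2)$. (A5) With $h_0=\min_{1\le j\le p^0}\|\beta_j^0\|_2$, there exist a constant $K>0$ and a real $\alpha>(c-1)/2$ such that $K\le n^{-\alpha}h_0$. Suppose also that $\lambda_n\to0$, $\lambda_n n^{1/2-\alpha\gamma}\to0$ and $\lambda_n n^{(1-c)(1+\gamma)/2}\to+\infty$ as $n\to\infty$. Then $$\lim_{n\to\infty}\mathbb{P}\big[\widehat{\mathcal{A}}_n=\mathcal{A}\big]=1 .$$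
   Context: Model: for $i=1,\dots,n$, $Y_i=\sum_{j=1}^p\mathbf{X}_{ij}^\top\beta_j^0+\varepsilon_i=\mathbb{X}_i^\top\beta^0+\varepsilon_i$, where for each group $j\in\{1,\dots,p\}$ the deterministic design vector $\mathbf{X}_{ij}$ and the true (unknown) parameter $\beta_j^0$ lie in $\mathbb{R}^{d_j}$, $\mathbb{X}_i=(\mathbf{X}_{i1},\dots,\mathbf{X}_{ip})\in\mathbb{R}^r$, $\beta^0=(\beta_1^0,\dots,\beta_p^0)\in\mathbb{R}^r$, $r=\sum_{j=1}^p d_j$, and $\varepsilon_i$ is a random error. Any $\beta\in\mathbb{R}^r$ is written $\beta=(\beta_1,\dots,\beta_p)$ with $\beta_j\in\mathbb{R}^{d_j}$. It is assumed that $\|\beta_j^0\|_2\ne0$ for $j\le p^0$ and $\|\beta_j^0\|_2=0$ for $j>p^0$, where $p^0\le p$ is unknown. $\mathcal{A}=\{j:\|\beta_j^0\|_2\ne0\}=\{1,\dots,p^0\}$. The quantities $p$, $p^0$, $r$, $\mathcal{A}$, $\beta^0$ and the design may depend on $n$ (the dependence is not displayed); the constants in the assumptions do not depend on $n$. For a fixed $\tau\in(0,1)$: $\rho_\tau(u)=u^2\,|\tau-\mathbb{1}_{u<0}|$ and $g_\tau(\varepsilon)=-2\varepsilon(\tau\mathbb{1}_{\varepsilon\ge0}+(1-\tau)\mathbb{1}_{\varepsilon<0})$. Expectile estimator: $\widetilde{\beta}_n=(\widetilde{\beta}_{n;1},\dots,\widetilde{\beta}_{n;p})=\arg\min_{\beta\in\mathbb{R}^r}\sum_{i=1}^n\rho_\tau(Y_i-\mathbb{X}_i^\top\beta)$.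 Adaptive group LASSO expectile estimator: $\widehat{\beta}_n=(\widehat{\beta}_{n;1},\dots,\widehat{\beta}_{n;p})=\arg\min_{\beta\in\mathbb{R}^r}\big\{n^{-1}\sum_{i=1}^n\rho_\tau(Y_i-\mathbb{X}_i^\top\beta)+\lambda_n\sum_{j=1}^p\widehat{\omega}_{n;j}\|\beta_j\|_2\big\}$, with weights $\widehat{\omega}_{n;j}=\|\widetilde{\beta}_{n;j}\|_2^{-\gamma}$, where $\gamma>0$ is a known constant and $(\lambda_n)$ is a sequence of positive tuning parameters. $\widehat{\mathcal{A}}_n=\{j\in\{1,\dots,p\}:\|\widehat{\beta}_{n;j}\|_2\ne0\}$. $\delta_{\min},\delta_{\max}$ denote smallest and largest eigenvalues; $\|\cdot\|_2$, $\|\cdot\|_\infty$ are the Euclidean and sup norms.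
   Formalization: The formal theorem additionally assumes that the total dimension r = d_1+...+d_p is O(n^c), with the same c as in (A4); this holds when group sizes are bounded, and without such a condition the claim fails for groups of rapidly growing size. *)

(* Defs.v *)
From HB Require Import structures.
From mathcomp Require Import all_boot all_order all_algebra finmap.
From mathcomp Require Import all_classical all_reals all_analysis.

Set Implicit Arguments.
Unset Strict Implicit.
Unset Printing Implicit Defensive.

Import Order.TTheory GRing.Theory Num.Theory.
Import numFieldNormedType.Exports.

Local Open Scope classical_set_scope.
Local Open Scope ring_scope.

(** A vector [beta] of [R^r], [r = d_1 + ... + d_p], is a column matrix of type
    ['cV[R]_(\sum_j d j)]; its block [beta_j] is [submxcol beta j]. *)

Definition norm2 {R : realType} {k : nat} (v : 'cV[R]_k) : R :=
  Num.sqrt (\sum_(i < k) v i 0 ^+ 2).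

Definition dot {R : realType} {k : nat} (u v : 'cV[R]_k) : R := (u^T *m v) 0 0.

(** Only used for real symmetric matrices of positive size: the set of real
    eigenvalues is then finite and nonempty, so that [inf] and [sup] are a
    minimum and a maximum. *)
Definition delta_min {R : realType} {k : nat} (A : 'M[R]_k) : R :=
  inf [set a : R | eigenvalue A a].

Definition delta_max {R : realType} {k : nat} (A : 'M[R]_k) : R :=
  sup [set a : R | eigenvalue A a].

Definition is_argmin {disp : Order.disp_t} {V : Type} {L : porderType disp}
  (F : V -> L) (b : V) : Prop := forall b' : V, (F b <= F b')%O.

Definition rho {R : realType} (tau u : R) : R := u ^+ 2 * `|tau - (u < 0)%R%:R|.

Definition g_tau {R : realType} (tau e : R) : R :=
  - 2 * e * (tau * (0 <= e)%R%:R + (1 - tau) * (e < 0)%R%:R).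

Section Probability.
Context {d : measure_display} {T : measurableType d} {R : realType}.
Variable P : probability T R.

Definition mutually_independent (Z : nat -> {RV P >-> R}) : Prop :=
  forall (I : {fset nat}) (B : nat -> set R),
    (forall i, measurable (B i)) ->
    P (\bigcap_(i in [set` I]) (Z i @^-1` B i)) =
    (\big[*%E/1]_(i <- I) P (Z i @^-1` B i))%E.

Definition identically_distributed (Z : nat -> {RV P >-> R}) : Prop :=
  forall (i j : nat) (B : set R), measurable B ->
    distribution P (Z i) B = distribution P (Z j) B.

Definition has_density (Z : {RV P >-> R}) (f : R -> R) : Prop :=
  [/\ measurable_fun setT f, (forall x, 0 <= f x) &
      forall B : set R, measurable B ->
        distribution P Z B = (\int[lebesgue_measure]_(x in B) (f x)%:E)%E].

End Probability.

Section GroupedModel.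
Context {R : realType} {p : nat} {d : 'I_p -> nat}.
Local Notation vec := ('cV[R]_(\sum_(j < p) d j)).

Definition active (b : vec) : {set 'I_p} :=
  [set j | norm2 (submxcol b j) != 0]%SET.

Variables (n : nat) (X : 'I_n -> vec).

Definition response (b0 : vec) (e : 'I_n -> R) (i : 'I_n) : R :=
  dot (X i) b0 + e i.

Definition gram : 'M[R]_(\sum_(j < p) d j) :=
  n%:R^-1 *: \sum_(i < n) (X i *m (X i)^T).

Definition expectile_loss (tau : R) (Y : 'I_n -> R) (b : vec) : R :=
  \sum_(i < n) rho tau (Y i - dot (X i) b).

(** [powR] sends [0] to [0] even for negative exponents, whereas here
    [0 `^ (- gamma)] has to be infinite: a group whose pilot estimate vanishes
    is then forced out, since [+oo * 0 = 0] and [+oo * x = +oo] for [x > 0]. *)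
Definition adaptive_weight (gamma : R) (bt : vec) (j : 'I_p) : \bar R :=
  if norm2 (submxcol bt j) == 0 then +oo%E
  else (norm2 (submxcol bt j) `^ (- gamma))%:E.

Definition lasso_objective (tau gamma lambda : R) (Y : 'I_n -> R) (bt b : vec)
    : \bar R :=
  ((n%:R^-1 * expectile_loss tau Y b)%:E +
   lambda%:E *
     \sum_(j < p) adaptive_weight gamma bt j * (norm2 (submxcol b j))%:E)%E.

(** The empty minimum, which occurs when [p0 = 0], is [+oo]. *)
Definition min_signal (p0 : nat) (b0 : vec) : \bar R :=
  \big[Order.min/+oo%E]_(j < p | (j < p0)%N) (norm2 (submxcol b0 j))%:E.

End GroupedModel.

(* Main.v *)
Require Import Defs.
From HB Require Import structures.
From mathcomp Require Import all_boot all_order all_algebra finmap.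
From mathcomp Require Import all_classical all_reals all_analysis.
From mathcomp Require Import measurable_realfun ring lra.

Set Implicit Arguments.
Unset Strict Implicit.
Unset Printing Implicit Defensive.

Import Order.TTheory GRing.Theory Num.Theory.
Import numFieldNormedType.Exports.

Local Open Scope classical_set_scope.
Local Open Scope ring_scope.

(** Let [S] be the score at [beta0], [S = sum_i g_tau(eps_i) X_i]. Independence
    and [E g_tau(eps_i) = 0] give [E |S|^2 = v sum_i |X_i|^2 = O(n^(1+c))], so on
    an event of probability close to 1 one has [|S| <= n s] with
    [s = M n^((c-1)/2)]. The rest is deterministic on that event. The loss is
    strongly convex with a Lipschitz gradient, hence the pilot estimator is
    within [t = O(s)] of [beta0]; the weights of the active groups are then at
    most [(h_0/2)^-gamma] and the basic inequality puts the LASSO estimator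
    within [2 t] of [beta0], so that no active group is lost. If an inactive
    group [j] were selected, setting its block to zero would lower the objective:
    the loss changes by [O(s) |beta_j|], whereas the penalty drops by at least
    [lambda t^-gamma |beta_j|], which is larger.

    The estimators are arbitrary minimizers, so the measurability of the event
    has to be proved as well; the strong convexity yields it, by comparing the
    objective at countably many rational points. *)

(** * Euclidean geometry of block vectors *)

Section Euclidean.
Context {R : realType}.

Lemma cauchy_schwarz_sum (I : finType) (a b : I -> R) :
  (\sum_i a i * b i) ^+ 2 <= (\sum_i a i ^+ 2) * (\sum_i b i ^+ 2).
Proof.
set A := \sum_i a i ^+ 2; set B := \sum_i b i ^+ 2; set C := \sum_i a i * b i.
have B0 : 0 <= B by apply: sumr_ge0 => i _; exact: sqr_ge0.
(* This number is the squared norm of [B a - C b]. Cancelling [B] leaves only the case [B = 0],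
   where [b] vanishes. *)
have : 0 <= B * (A * B - C ^+ 2).
  suff -> : B * (A * B - C ^+ 2) = \sum_i (B * a i - C * b i) ^+ 2.
    by apply: sumr_ge0 => i _; exact: sqr_ge0.
  suff E x y : x ^+ 2 * A - (2 * x * y) * C + y ^+ 2 * B =
      \sum_i (x * a i - y * b i) ^+ 2.
    by rewrite -E; ring.
  rewrite !mulr_sumr -sumrB -big_split /=.
  by apply: eq_bigr => i _; ring.
have [B00|BN0] := eqVneq B 0.
  move=> _; suff -> : C = 0.
    by rewrite expr0n /= mulr_ge0// sumr_ge0// => i _; exact: sqr_ge0.
  apply: big1 => i _.
  have /eqP : b i ^+ 2 = 0.
    apply: (psumr_eq0P (P := xpredT) (F := fun i => b i ^+ 2)) => // j _.
    exact: sqr_ge0.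
  by rewrite sqrf_eq0 => /eqP ->; rewrite mulr0.
by rewrite pmulr_rge0 ?subr_ge0// lt_def BN0.
Qed.

Variable k : nat.
Implicit Types u v w : 'cV[R]_k.

Lemma dotE u v : dot u v = \sum_(i < k) u i 0 * v i 0.
Proof. by rewrite /dot mxE; apply: eq_bigr => i _; rewrite mxE. Qed.

Lemma dotC u v : dot u v = dot v u.
Proof. by rewrite !dotE; apply: eq_bigr => i _; rewrite mulrC. Qed.

Lemma dotDr u v w : dot u (v + w) = dot u v + dot u w.
Proof. by rewrite /dot mulmxDr mxE. Qed.

Lemma dotZr a u v : dot u (a *: v) = a * dot u v.
Proof. by rewrite /dot -scalemxAr mxE. Qed.

Lemma dotNr u v : dot u (- v) = - dot u v.
Proof. by rewrite /dot mulmxN mxE. Qed.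

Lemma dotBr u v w : dot u (v - w) = dot u v - dot u w.
Proof. by rewrite dotDr dotNr. Qed.

Lemma dotDl u v w : dot (u + v) w = dot u w + dot v w.
Proof. by rewrite dotC dotDr !(dotC w). Qed.

Lemma dotZl a u v : dot (a *: u) v = a * dot u v.
Proof. by rewrite dotC dotZr dotC. Qed.

Lemma dot_suml I (r : seq I) (F : I -> 'cV[R]_k) u :
  dot (\sum_(i <- r) F i) u = \sum_(i <- r) dot (F i) u.
Proof.
apply: (big_rec2 (fun x y => dot x u = y)) => [|i x y _ <-]; last by rewrite dotDl.
by rewrite /dot trmx0 mul0mx mxE.
Qed.

Lemma norm2_ge0 u : 0 <= norm2 u. Proof. exact: sqrtr_ge0. Qed.

Lemma norm2_sqr u : norm2 u ^+ 2 = dot u u.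
Proof.
rewrite sqr_sqrtr ?dotE; first by apply: eq_bigr => i _; rewrite expr2.
by apply: sumr_ge0 => i _; exact: sqr_ge0.
Qed.

Lemma norm2_0 : norm2 (0 : 'cV[R]_k) = 0.
Proof. by rewrite /norm2 big1 ?sqrtr0// => i _; rewrite mxE expr0n. Qed.

Lemma norm2_eq0 u : (norm2 u == 0) = (u == 0).
Proof.
apply/eqP/eqP => [u0|->]; last exact: norm2_0.
have := norm2_sqr u; rewrite u0 expr0n /= dotE => /esym uu0.
apply/colP => i; rewrite mxE; apply/eqP; rewrite -sqrf_eq0 expr2; apply/eqP.
apply: (psumr_eq0P (P := xpredT) (F := fun i => u i 0 * u i 0)) => // j _.
by rewrite -expr2 sqr_ge0.
Qed.

Lemma ler_norm2_dot u v : `|dot u v| <= norm2 u * norm2 v.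
Proof.
rewrite -ler_sqr ?nnegrE ?mulr_ge0 ?norm2_ge0//.
rewrite exprMn !norm2_sqr real_normK ?num_real// !dotE.
exact: (cauchy_schwarz_sum (fun i => u i 0) (fun i => v i 0)).
Qed.

Lemma norm2D u v : norm2 (u + v) <= norm2 u + norm2 v.
Proof.
rewrite -ler_sqr ?nnegrE ?addr_ge0 ?norm2_ge0// norm2_sqr.
rewrite dotDr !dotDl (dotC v u) sqrrD !norm2_sqr.
have := ler_norm2_dot u v; have := ler_norm (dot u v); lra.
Qed.

Lemma norm2Z a u : norm2 (a *: u) = `|a| * norm2 u.
Proof.
apply/eqP; rewrite -(@eqrXn2 _ 2) ?mulr_ge0 ?norm2_ge0 ?normr_ge0//.
by rewrite exprMn !norm2_sqr dotZr dotZl real_normK ?num_real// expr2 mulrA.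
Qed.

Lemma norm2N u : norm2 (- u) = norm2 u.
Proof. by rewrite -scaleN1r norm2Z normrN1 mul1r. Qed.

Lemma norm2_coord u i : `|u i 0| <= norm2 u.
Proof.
rewrite -ler_sqr ?nnegrE ?norm2_ge0// norm2_sqr real_normK ?num_real// dotE.
rewrite (bigD1 i) //= expr2 lerDl; apply: sumr_ge0 => j _.
by rewrite -expr2 sqr_ge0.
Qed.

End Euclidean.

Section Blocks.
Context {R : realType} {p : nat} {d : 'I_p -> nat}.
Local Notation vec := ('cV[R]_(\sum_(j < p) d j)).
Implicit Types u v b : vec.

Lemma dot_blocks u v : dot u v = \sum_j dot (submxcol u j) (submxcol v j).
Proof.
rewrite /dot -{1}(submxcolK u) -{1}(submxcolK v) tr_mxcol mul_mxrow_mxcol summxE.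
by [].
Qed.

Lemma norm2_blocks u : norm2 u ^+ 2 = \sum_j norm2 (submxcol u j) ^+ 2.
Proof. by rewrite norm2_sqr dot_blocks; apply: eq_bigr => j _; rewrite norm2_sqr. Qed.

Lemma norm2_block_le u j : norm2 (submxcol u j) <= norm2 u.
Proof.
rewrite -ler_sqr ?nnegrE ?norm2_ge0// norm2_blocks (bigD1 j)//= lerDl.
by apply: sumr_ge0 => i _; exact: sqr_ge0.
Qed.

Lemma norm2_blocks_mono u v :
  (forall j, norm2 (submxcol u j) <= norm2 (submxcol v j)) -> norm2 u <= norm2 v.
Proof.
move=> uv; rewrite -ler_sqr ?nnegrE ?norm2_ge0// !norm2_blocks.
by apply: ler_sum => j _; rewrite ler_sqr ?nnegrE ?norm2_ge0.
Qed.

(** Cauchy-Schwarz against the constant vector [1]. This is where the factor [Num.sqrt p%:R] of the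
    condition on [lambda] comes from. *)
Lemma sum_norm2_blocks u :
  \sum_j norm2 (submxcol u j) <= Num.sqrt p%:R * norm2 u.
Proof.
rewrite -ler_sqr ?nnegrE ?mulr_ge0 ?norm2_ge0 ?sqrtr_ge0 ?sumr_ge0//; last first.
  by move=> j _; exact: norm2_ge0.
have := cauchy_schwarz_sum (fun=> 1) (fun j => norm2 (submxcol u j)).
rewrite exprMn sqr_sqrtr ?ler0n// norm2_blocks.
under eq_bigr do rewrite mul1r.
under [in X in _ <= X * _ -> _]eq_bigr do rewrite expr1n.
by rewrite sumr_const card_ord.
Qed.

(** The competitor against which a wrongly selected group is tested. *)
Definition zero_block b (j : 'I_p) : vec :=
  \mxcol_i (if i == j then 0 else submxcol b i).

Lemma zero_blockE b j i :
  submxcol (zero_block b j) i = if i == j then 0 else submxcol b i.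
Proof. by rewrite /zero_block mxcolK. Qed.

End Blocks.

(** * The expectile loss and the group LASSO objective *)

Section Expectile.
Context {R : realType}.
Variables (tau kappa : R).
Hypotheses (htau : 0 < tau < 1) (hk : kappa <= tau) (hk' : kappa <= 1 - tau).

Lemma rhoE u : rho tau u = (if u < 0 then 1 - tau else tau) * u ^+ 2.
Proof.
case/andP: htau => t0 t1; rewrite /rho mulrC; case: ifP => _ /=.
  by rewrite distrC ger0_norm// subr_ge0 ltW.
by rewrite subr0 gtr0_norm.
Qed.

Lemma g_tauE u : g_tau tau u = - 2 * (if u < 0 then 1 - tau else tau) * u.
Proof.
rewrite /g_tau leNgt; case: ifP => _ /=; rewrite ?(mulr0, mulr1, add0r, addr0); ring.
Qed.

(** Strong convexity: [- g_tau tau u] is the derivative of [rho tau] at [u], and the curvature is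
    [2 * tau] or [2 * (1 - tau)], hence at least [2 * kappa]. When [u] and [v] lie on different
    sides of [0], the sign of [u * v] supplies what is missing. *)
Lemma rho_lower u v :
  rho tau u - g_tau tau u * (v - u) + kappa * (v - u) ^+ 2 <= rho tau v.
Proof.
case/andP: htau => t0 t1; rewrite !rhoE g_tauE.
have k1 : 0 <= tau - kappa by rewrite subr_ge0.
have k2 : 0 <= 1 - tau - kappa by rewrite subr_ge0.
have [[u1 v1] d1] := (mulr_ge0 k1 (sqr_ge0 u), mulr_ge0 k1 (sqr_ge0 v),
  mulr_ge0 k1 (sqr_ge0 (v - u))).
have [[u2 v2] d2] := (mulr_ge0 k2 (sqr_ge0 u), mulr_ge0 k2 (sqr_ge0 v),
  mulr_ge0 k2 (sqr_ge0 (v - u))).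
case: ltP => u0; case: ltP => v0; [lra| | |lra].
- have : 0 <= - (u * v) by rewrite -mulNr mulr_ge0// oppr_ge0 ltW.
  by move/(mulr_ge0 k2); lra.
- have : 0 <= - (u * v) by rewrite -mulrN mulr_ge0// oppr_ge0 ltW.
  by move/(mulr_ge0 k1); lra.
Qed.

(** [g_tau tau] is continuous and piecewise linear with slopes [- 2 * tau] and [- 2 * (1 - tau)]. *)
Lemma g_tau_lipschitz u v : `|g_tau tau u - g_tau tau v| <= 2 * `|u - v|.
Proof.
case/andP: htau => t0 t1; rewrite !g_tauE.
wlog uv : u v / v <= u.
  move=> H; have [/H//|/ltW/H] := leP v u.
  by rewrite distrC (distrC v).
rewrite (ger0_norm (x := u - v)) ?subr_ge0// ler_norml.
by case: ltP => u0; case: ltP => v0; apply/andP; split; nra.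
Qed.

End Expectile.

Section GroupedModel.
Context {R : realType} {p : nat} {d : 'I_p -> nat}.
Local Notation vec := ('cV[R]_(\sum_(j < p) d j)).
Variables (n : nat) (X : 'I_n -> vec) (tau kappa : R).
Hypotheses (htau : 0 < tau < 1) (hk : kappa <= tau) (hk' : kappa <= 1 - tau).
Implicit Types (Y : 'I_n -> R) (b bt h u : vec).

(** The gradient of the expectile loss at [b]. *)
Definition score Y b : vec := \sum_i g_tau tau (Y i - dot (X i) b) *: X i.

(** The quadratic form of [n] times the Gram matrix, kept as a sum so that bounds on single
    observations add up to it. *)
Definition design_sqr h : R := \sum_i dot (X i) h ^+ 2.

Lemma dot_score Y b u :
  dot (score Y b) u = \sum_i g_tau tau (Y i - dot (X i) b) * dot (X i) u.
Proof. by rewrite dot_suml; apply: eq_bigr => i _; rewrite dotZl. Qed.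

Lemma expectile_loss_lower Y b h :
  expectile_loss X tau Y b + dot (score Y b) h + kappa * design_sqr h <=
  expectile_loss X tau Y (b + h).
Proof.
rewrite dot_score mulr_sumr -!big_split /=; apply: ler_sum => i _.
apply: le_trans (rho_lower htau hk hk' (Y i - dot (X i) b) _).
by rewrite dotDr le_eqVlt; apply/orP; left; apply/eqP; ring.
Qed.

(** The Lipschitz bound on [g_tau] is applied to each observation, then Cauchy-Schwarz over the
    observations turns the sum of products into two values of [design_sqr]. *)
Lemma score_lipschitz (B : R) Y b b' u :
  (forall h, design_sqr h <= B * norm2 h ^+ 2) ->
  `|dot (score Y b) u - dot (score Y b') u| <= 2 * B * norm2 (b - b') * norm2 u.
Proof.
move=> hB; rewrite !dot_score -sumrB.
apply: (@le_trans _ _ (2 * \sum_i `|dot (X i) (b - b')| * `|dot (X i) u|)).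
  rewrite mulr_sumr; apply: le_trans (ler_norm_sum _ _ _) _.
  apply: ler_sum => i _; rewrite -mulrBl normrM mulrA ler_wpM2r//.
  apply: le_trans (g_tau_lipschitz htau _ _) _.
  rewrite dotBr -normrN ler_pM2l// le_eqVlt.
  by apply/orP; left; apply/eqP; congr `|_|; ring.
rewrite -!mulrA ler_pM2l// mulrA.
(* A negative [B] forces every vector to have norm [0], so the right-hand side is nonnegative in
   both cases and the inequality may be squared. *)
have B0 : 0 <= B \/ (forall h, norm2 h = 0).
  have [B0|B0] := leP 0 B; [by left|right] => h.
  have : 0 <= B * norm2 h ^+ 2.
    by apply: le_trans (hB h); apply: sumr_ge0 => i _; exact: sqr_ge0.
  have := sqr_ge0 (norm2 h) => s0 s1.
  by apply/eqP; rewrite -sqrf_eq0; apply/eqP; nra.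
have rhs0 : 0 <= B * norm2 (b - b') * norm2 u.
  by case: B0 => [B0|->]; [rewrite !mulr_ge0 ?norm2_ge0|rewrite mulr0 mul0r].
rewrite -ler_sqr ?nnegrE ?sumr_ge0//.
apply: le_trans (cauchy_schwarz_sum _ _) _.
under eq_bigr do rewrite real_normK ?num_real//.
under [X in _ * X]eq_bigr do rewrite real_normK ?num_real//.
apply: (@le_trans _ _ ((B * norm2 (b - b') ^+ 2) * (B * norm2 u ^+ 2))).
  by apply: ler_pM; rewrite ?hB// sumr_ge0// => i _; exact: sqr_ge0.
by rewrite le_eqVlt; apply/orP; left; apply/eqP; ring.
Qed.

(** The objective where it is finite. [powR] gives weight [0] to a group whose pilot block vanishes,
    which agrees with [+oo * 0 = 0] there. *)
Definition lasso_real (gamma lambda : R) Y (bt b : vec) : R :=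
  n%:R^-1 * expectile_loss X tau Y b +
  lambda * \sum_j norm2 (submxcol bt j) `^ (- gamma) * norm2 (submxcol b j).

(** Infinite weights act as a hard constraint: [b] must vanish wherever the pilot does. The rest of
    the objective is real-valued. *)
Lemma lasso_objectiveE (gamma lambda : R) Y (bt b : vec) : 0 < lambda ->
  lasso_objective X tau gamma lambda Y bt b =
  if [forall j, (norm2 (submxcol bt j) == 0) ==> (norm2 (submxcol b j) == 0)]
  then (lasso_real gamma lambda Y bt b)%:E else +oo%E.
Proof.
move=> l0; rewrite /lasso_objective /lasso_real /adaptive_weight.
case: ifPn => [/forallP H|/forallPn[j]].
  rewrite EFinD; congr (_ + _)%E; rewrite EFinM -sumEFin; congr (_ * _)%E.
  apply: eq_bigr => j _; have := H j; case: eqP => [-> /eqP ->|_ _] //=.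
  by rewrite mule0 mulr0.
rewrite negb_imply => /andP[bt0 b0].
rewrite (bigD1 j)//= bt0 gt0_mulye; last first.
  by rewrite lte_fin lt_def b0 norm2_ge0.
rewrite addye.
  by rewrite gt0_muley ?lte_fin//.
rewrite gt_eqF// (@lt_le_trans _ _ 0%E)//; apply: sume_ge0 => i _.
by case: ifP => _; rewrite mule_ge0// ?lee_fin ?norm2_ge0 ?powR_ge0// leey.
Qed.

End GroupedModel.

(** * Deterministic selection *)

Section Selection.
Context {R : realType} {p : nat} {d : 'I_p -> nat}.
Local Notation vec := ('cV[R]_(\sum_(j < p) d j)).

Lemma norm2_sub_zero_block (b : vec) j :
  norm2 (b - zero_block b j) = norm2 (submxcol b j).
Proof.
apply/eqP; rewrite -(@eqrXn2 _ 2) ?norm2_ge0// norm2_blocks (bigD1 j)//=.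
rewrite submxcolB zero_blockE eqxx subr0 [X in _ + X]big1 ?addr0//.
by move=> i /negPf ij; rewrite submxcolB zero_blockE ij subrr norm2_0 expr0n.
Qed.

Lemma powRN_le (x y a : R) : 0 <= a -> 0 < x -> x <= y -> y `^ (- a) <= x `^ (- a).
Proof.
move=> a0 x0 xy; have y0 := lt_le_trans x0 xy.
rewrite !powRN lef_pV2 ?posrE ?powR_gt0//.
by apply: ge0_ler_powR => //; rewrite nnegrE ltW.
Qed.

Variables (n : nat) (X : 'I_n -> vec) (tau kappa : R).
Hypotheses (htau : 0 < tau < 1) (hk : kappa <= tau) (hk' : kappa <= 1 - tau).
Implicit Types (Y : 'I_n -> R) (b bt h u : vec).

Lemma design_sqr_ge0 h : 0 <= design_sqr X h.
Proof. by apply: sumr_ge0 => i _; exact: sqr_ge0. Qed.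

Lemma design_sqrZ a h : design_sqr X (a *: h) = a ^+ 2 * design_sqr X h.
Proof. by rewrite /design_sqr mulr_sumr; apply: eq_bigr => i _; rewrite dotZr exprMn. Qed.

(** The strong convexity bound is used at the midpoint in the two opposite directions [h] and [- h],
    so that the score terms cancel. *)
Lemma expectile_loss_midpoint Y b b' :
  2 * expectile_loss X tau Y (2^-1 *: (b + b')) +
    kappa / 2 * design_sqr X (b - b') <=
  expectile_loss X tau Y b + expectile_loss X tau Y b'.
Proof.
set z := 2^-1 *: (b + b'); set h := 2^-1 *: (b - b').
have zb : z + h = b by apply/colP => i; rewrite !mxE; field.
have zb' : z + - h = b' by apply/colP => i; rewrite !mxE; field.
have := expectile_loss_lower X htau hk hk' Y z h.
have := expectile_loss_lower X htau hk hk' Y z (- h).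
rewrite zb zb' -scaleN1r dotZr (design_sqrZ (-1)) /h design_sqrZ.
by lra.
Qed.

(** Quadratic growth away from the minimizer, obtained by comparing [m] with the midpoint of [b] and
    [m]. It is what makes the minimizer measurable. *)
Lemma expectile_argmin_gap Y m b : is_argmin (expectile_loss X tau Y) m ->
  expectile_loss X tau Y m + kappa / 2 * design_sqr X (b - m) <=
  expectile_loss X tau Y b.
Proof.
move=> /(_ (2^-1 *: (b + m))) mmin; have := expectile_loss_midpoint Y b m.
by move: mmin; lra.
Qed.

Lemma lasso_argmin_gap gamma lambda Y bt m b : 0 < lambda ->
  is_argmin (lasso_objective X tau gamma lambda Y bt) m ->
  (lasso_objective X tau gamma lambda Y bt m +
    (n%:R^-1 * (kappa / 2 * design_sqr X (b - m)))%:E <=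
   lasso_objective X tau gamma lambda Y bt b)%E.
Proof.
move=> l0 mmin; rewrite [leRHS]lasso_objectiveE//; case: ifPn => [bz|_]; last exact: leey.
have := mmin b; rewrite !lasso_objectiveE// bz; case: ifPn => [mz _|_ //].
(* The midpoint inherits the zero constraints shared by [b] and [m], so its objective is finite too;
   the penalty is convex and does not spoil the gap. *)
have := mmin (2^-1 *: (b + m)); rewrite !lasso_objectiveE// mz ifT; last first.
  apply/forallP => j; apply/implyP => btj.
  move/forallP : bz => /(_ j) /implyP /(_ btj); rewrite norm2_eq0 => /eqP b0.
  move/forallP : mz => /(_ j) /implyP /(_ btj); rewrite norm2_eq0 => /eqP m0.
  rewrite norm2_eq0; apply/eqP/colP => i.
  move/colP/(_ i) : b0; move/colP/(_ i) : m0; rewrite !mxE => -> ->.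
  by rewrite addr0 mulr0.
rewrite -EFinD !lee_fin /lasso_real.
have : 2 * \sum_j norm2 (submxcol bt j) `^ (- gamma) *
               norm2 (submxcol (2^-1 *: (b + m)) j) <=
    \sum_j norm2 (submxcol bt j) `^ (- gamma) * norm2 (submxcol b j) +
    \sum_j norm2 (submxcol bt j) `^ (- gamma) * norm2 (submxcol m j).
  rewrite mulr_sumr -big_split /=; apply: ler_sum => j _.
  rewrite mulrCA -mulrDr ler_wpM2l ?powR_ge0//.
  have -> : submxcol (2^-1 *: (b + m)) j = 2^-1 *: (submxcol b j + submxcol m j).
    by apply/colP => i; rewrite !mxE.
  by rewrite norm2Z ger0_norm ?invr_ge0// mulrA divff// mul1r norm2D.
move/(ler_wpM2l (ltW l0)).
have := ler_wpM2l (_ : 0 <= n%:R^-1) (expectile_loss_midpoint Y b m).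
rewrite invr_ge0 ler0n => /(_ isT); lra.
Qed.

Variables (gamma lambda m0 M0 s t eta : R) (Y : 'I_n -> R) (b0 bt bh : vec).
Hypotheses (n0 : (0 < n)%N) (kappa0 : 0 < kappa) (gamma0 : 0 <= gamma)
  (lambda0 : 0 < lambda) (hm0 : 0 < m0) (s0 : 0 < s).
Hypothesis hlow : forall h, m0 * n%:R * norm2 h ^+ 2 <= design_sqr X h.
Hypothesis hup : forall h, design_sqr X h <= M0 * n%:R * norm2 h ^+ 2.
Hypothesis hscore : norm2 (score X tau Y b0) <= n%:R * s.
Hypothesis heta :
  forall j, norm2 (submxcol b0 j) != 0 -> eta <= norm2 (submxcol b0 j).
Hypothesis tE : t = s / (kappa * m0).
Hypothesis ht : 2 * t < eta.
Hypothesis hlambda_small : lambda * (eta / 2) `^ (- gamma) * Num.sqrt p%:R <= s.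
Hypothesis hlambda_large : s + 4 * M0 * t < lambda * t `^ (- gamma).
Hypothesis hbt : is_argmin (expectile_loss X tau Y) bt.
Hypothesis hbh : is_argmin (lasso_objective X tau gamma lambda Y bt) bh.

Let t0 : 0 < t. Proof. by rewrite tE divr_gt0// mulr_gt0. Qed.

Let nR0 : 0 < n%:R :> R. Proof. by rewrite ltr0n. Qed.

Let norm2_bound h (c : R) :
  0 <= c -> kappa * design_sqr X h <= n%:R * c * norm2 h -> norm2 h <= c / (kappa * m0).
Proof.
move=> c0 H; have := le_trans (ler_wpM2l (ltW kappa0) (hlow h)) H.
have [->|hN0] := eqVneq (norm2 h) 0; first by rewrite divr_ge0// mulr_ge0// ltW.
have hp : 0 < norm2 h by rewrite lt_def hN0 norm2_ge0.
have -> : kappa * (m0 * n%:R * norm2 h ^+ 2) =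
    n%:R * norm2 h * (norm2 h * (kappa * m0)) by ring.
have -> : n%:R * c * norm2 h = n%:R * norm2 h * c by ring.
by rewrite ler_pM2l ?mulr_gt0// ler_pdivlMr ?mulr_gt0.
Qed.

Let score_dot h : - (n%:R * s * norm2 h) <= dot (score X tau Y b0) h.
Proof.
have := ler_norm2_dot (score X tau Y b0) h; rewrite ler_norml => /andP[+ _].
by apply: le_trans; rewrite lerN2 ler_wpM2r// norm2_ge0.
Qed.

(** The loss at [bt] does not exceed the loss at [b0], so the quadratic term is at most minus the
    score term, that is at most [n s] times the distance; one factor of the distance cancels. *)
Let bt_near : norm2 (bt - b0) <= t.
Proof.
rewrite tE; apply: norm2_bound; first exact: ltW.
have := expectile_loss_lower X htau hk hk' Y b0 (bt - b0).
rewrite subrKC; have := hbt b0; have := score_dot (bt - b0); lra.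
Qed.

Let bt_block_near j : norm2 (submxcol bt j - submxcol b0 j) <= t.
Proof. by rewrite -submxcolB (le_trans (norm2_block_le _ _)). Qed.

Let bt_large j : norm2 (submxcol b0 j) != 0 -> eta / 2 <= norm2 (submxcol bt j).
Proof.
move=> /heta etaj; have := bt_block_near j; rewrite -norm2N opprB.
have := norm2D (submxcol bt j) (submxcol b0 j - submxcol bt j).
rewrite subrKC; move: ht etaj; lra.
Qed.

Let eta0 : 0 < eta. Proof. by rewrite (lt_trans _ ht)// mulr_gt0. Qed.

Let compat b : bool :=
  [forall j, (norm2 (submxcol bt j) == 0) ==> (norm2 (submxcol b j) == 0)].

(** No active group has a vanishing pilot block, so the true parameter is a competitor with finite
    objective. *)
Let compat_b0 : compat b0.
Proof.
apply/forallP => j; apply/implyP => /eqP bt0; apply/eqP/eqP.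
by apply: contraT => /bt_large; rewrite bt0; have := eta0; lra.
Qed.

Let compat_bh : compat bh.
Proof.
have := hbh b0; rewrite !lasso_objectiveE// -!/(compat _) compat_b0.
by case: ifP.
Qed.

Let bh_min b : compat b ->
  lasso_real X tau gamma lambda Y bt bh <= lasso_real X tau gamma lambda Y bt b.
Proof.
by move=> cb; have := hbh b; rewrite !lasso_objectiveE// -!/(compat _) compat_bh cb.
Qed.

(** The basic inequality against [b0]. The score contributes one [s] and the penalty, through
    [hlambda_small], another; hence the factor [2]. *)
Let bh_near : norm2 (bh - b0) <= 2 * t.
Proof.
rewrite tE mulrA; apply: norm2_bound; first by rewrite mulr_ge0// ltW.
have := expectile_loss_lower X htau hk hk' Y b0 (bh - b0); rewrite subrKC.
have /(ler_wpM2l (ltW nR0)) := bh_min compat_b0.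
rewrite /lasso_real !mulrDr !mulVKf ?gt_eqF//.
have := score_dot (bh - b0).
have : \sum_j norm2 (submxcol bt j) `^ (- gamma) * norm2 (submxcol b0 j) -
      \sum_j norm2 (submxcol bt j) `^ (- gamma) * norm2 (submxcol bh j) <=
    (eta / 2) `^ (- gamma) * (Num.sqrt p%:R * norm2 (bh - b0)).
  apply: (@le_trans _ _ ((eta / 2) `^ (- gamma) * \sum_j norm2 (submxcol (bh - b0) j))).
    rewrite mulr_sumr -sumrB; apply: ler_sum => j _; rewrite -mulrBr submxcolB.
    (* An inactive group only lowers the penalty difference. On an active one the pilot block is at
       least [eta / 2], which bounds the weight. *)
    have [b00|bN0] := eqVneq (norm2 (submxcol b0 j)) 0.
      rewrite b00 sub0r mulrN; apply: (@le_trans _ _ 0).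
        by rewrite oppr_le0 mulr_ge0 ?norm2_ge0 ?powR_ge0.
      by rewrite mulr_ge0 ?norm2_ge0 ?powR_ge0.
    have bd : norm2 (submxcol b0 j) - norm2 (submxcol bh j) <=
        norm2 (submxcol bh j - submxcol b0 j).
      have := norm2D (submxcol bh j) (submxcol b0 j - submxcol bh j).
      by rewrite subrKC -(norm2N (submxcol b0 j - _)) opprB; lra.
    apply: (@le_trans _ _ (norm2 (submxcol bt j) `^ (- gamma) *
        norm2 (submxcol bh j - submxcol b0 j))).
      by rewrite ler_wpM2l ?powR_ge0.
    rewrite ler_wpM2r ?norm2_ge0// powRN_le ?bt_large// divr_gt0//.
  by rewrite ler_wpM2l ?powR_ge0 ?sum_norm2_blocks.
move/(ler_wpM2l (ltW lambda0)).
have := ler_wpM2r (norm2_ge0 (bh - b0)) hlambda_small.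
set A := (eta / 2) `^ _; set x := norm2 (bh - b0); set q := Num.sqrt _.
move=> H1 H2; have := ler_wpM2l (ltW nR0) (le_trans H2 (_ : _ <= s * x)).
rewrite (_ : lambda * (A * (q * x)) = lambda * A * q * x); last by ring.
by move=> /(_ H1); lra.
Qed.

Lemma lasso_selection : active bh = active b0.
Proof.
apply/setP => j; rewrite !inE.
have [b00|bN0] := eqVneq (norm2 (submxcol b0 j)) 0; last first.
  apply: contraTneq ht => bh0; rewrite -leNgt (le_trans (heta bN0))//.
  rewrite (le_trans _ bh_near)// (le_trans _ (norm2_block_le _ j))//.
  move/eqP : bh0; rewrite norm2_eq0 submxcolB => /eqP ->.
  by rewrite sub0r norm2N.
apply/eqP; apply: contraTeq hlambda_large => bhj; rewrite -leNgt.
have btj : norm2 (submxcol bt j) != 0.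
  by apply: contraNN bhj; move: compat_bh => /forallP/(_ j)/implyP.
pose b' := zero_block bh j.
have cb' : compat b'.
  apply/forallP => i; apply/implyP; rewrite zero_blockE.
  case: ifP => [_ _|_]; first by rewrite norm2_0.
  by move: compat_bh => /forallP/(_ i)/implyP.
have bhj0 : 0 < norm2 (submxcol bh j) by rewrite lt_def bhj norm2_ge0.
(* Block [j] of [b0] is zero, so zeroing it in [bh] cannot move away from [b0]. *)
have b'near : norm2 (b' - b0) <= 2 * t.
  apply: le_trans bh_near; apply: norm2_blocks_mono => i.
  rewrite !submxcolB zero_blockE; case: ifP => // /eqP ->.
  move/eqP : b00; rewrite norm2_eq0 => /eqP ->.
  by rewrite !subr0 norm2_0 norm2_ge0.
have := bh_min cb'; rewrite /lasso_real.
rewrite (bigD1 j)//= [X in _ <= _ + _ * X](bigD1 j)//=.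
rewrite zero_blockE eqxx norm2_0 mulr0 add0r.
rewrite [X in _ <= _ + _ * X](eq_bigr
  (fun i => norm2 (submxcol bt i) `^ (- gamma) * norm2 (submxcol bh i))); last first.
  by move=> i /negPf ij; rewrite zero_blockE ij.
set S := \sum_(_ | _) _ => H.
(* Expanding at [b'] bounds the increase of the loss by the score at [b'] along the removed block.
   That score is within [2 M0 n (2 t)] of the one at [b0], which gives the [4 * M0 * t] of
   [hlambda_large]. *)
have := expectile_loss_lower X htau hk hk' Y b' (bh - b'); rewrite subrKC.
have := mulr_ge0 (ltW kappa0) (design_sqr_ge0 (bh - b')).
have := score_lipschitz htau Y b' b0 (bh - b') hup; rewrite ler_norml => /andP[+ _].
have := score_dot (bh - b').
rewrite norm2_sub_zero_block; set x := norm2 (submxcol bh j).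
rewrite -/x in bhj0 H.
move=> H1 H2 H3 H4.
(* The selected block makes [bh] nonzero, and [hup] at [bh] then gives the sign. *)
have M00 : 0 <= M0.
  have := le_trans (design_sqr_ge0 bh) (hup bh).
  rewrite -mulrA pmulr_lge0// mulr_gt0// exprn_gt0// lt_def norm2_ge0 andbT.
  apply: contraTneq (norm2_block_le bh j) => ->; rewrite -ltNge//.
have H5 : - (2 * (M0 * n%:R) * norm2 (b' - b0) * x) >= - (2 * (M0 * n%:R) * (2 * t) * x).
  rewrite lerN2 ler_wpM2r ?ler_wpM2l ?(ltW bhj0)//.
  by rewrite !mulr_ge0 ?(ltW nR0).
have : expectile_loss X tau Y b' - expectile_loss X tau Y bh <=
    n%:R * (s + 4 * M0 * t) * x by lra.
have {}H : lambda * norm2 (submxcol bt j) `^ (- gamma) * x <=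
  n%:R^-1 * (expectile_loss X tau Y b' - expectile_loss X tau Y bh) by lra.
have ni0 : 0 <= n%:R^-1 :> R by rewrite invr_ge0 ltW.
move=> /(ler_wpM2l ni0)/(le_trans H).
rewrite -(mulrA n%:R) mulKf ?gt_eqF// ler_pM2r//; apply: le_trans.
(* Since the true block is zero, the pilot block has norm at most [t], so its weight is at least [t]
   to the power [- gamma]. *)
rewrite ler_pM2l//; apply: powRN_le => //; first by rewrite lt_def btj norm2_ge0.
have := bt_block_near j; move/eqP : b00; rewrite norm2_eq0 => /eqP ->.
by rewrite subr0.
Qed.

End Selection.

(** * Rayleigh quotients *)

Section Rayleigh.
Context {R : realType}.

(** First-order condition at a minimum. The test value [- x / (y + 1)] avoids dividing by a
    vanishing [y]. *)
Lemma linear_term_eq0 (x y : R) : (forall t, 0 <= 2 * t * x + t ^+ 2 * y) -> x = 0.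
Proof.
move=> H; have y0 : 0 <= y by have := H 1; have := H (-1); lra.
have y1 : 0 < y + 1 by lra.
have := H (- x / (y + 1)).
have -> : 2 * (- x / (y + 1)) * x + (- x / (y + 1)) ^+ 2 * y =
   - (x ^+ 2 * ((y + 2) / (y + 1) ^+ 2)) by field; rewrite gt_eqF.
rewrite oppr_ge0 pmulr_lle0; last by rewrite divr_gt0 ?exprn_gt0//; lra.
by move=> x0; apply/eqP; rewrite -sqrf_eq0 eq_le x0 sqr_ge0.
Qed.

Variable k : nat.
Implicit Types (A : 'M[R]_k) (v w : 'cV[R]_k).

Lemma dot_mulmx A v w : dot v (A *m w) = dot (A^T *m v) w.
Proof. by rewrite /dot trmx_mul trmxK mulmxA. Qed.

Lemma dot_eq0 v : (forall w, dot v w = 0) -> v = 0.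
Proof.
move=> H; apply/eqP; rewrite -norm2_eq0 -sqrf_eq0 norm2_sqr; exact/eqP.
Qed.

Lemma continuous_quadratic A :
  continuous (fun v : 'rV[R]_k => dot v^T (A *m v^T)).
Proof.
have -> : (fun v : 'rV[R]_k => dot v^T (A *m v^T)) =
    (fun v : 'rV[R]_k => \sum_i (v 0 i * \sum_j A i j * v 0 j)).
  apply/funext => v; rewrite dotE; apply: eq_bigr => i _; rewrite !mxE.
  by congr (_ * _); apply: eq_bigr => j _; rewrite !mxE.
apply: continuous_big => [|i _ v]; first exact: add_continuous.
apply: cvgM; [exact: nbhs_filter|exact: coord_continuous|].
move: v; apply: continuous_big => [|j _ v]; first exact: add_continuous.
by apply: cvgM; [exact: nbhs_filter|exact: cst_continuous|exact: coord_continuous].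
Qed.

(* A minimizer of the quadratic form on the unit sphere is an eigenvector: for
   the minimum [a], the form of [A - a] is nonnegative and vanishes at it. *)
Lemma symmetric_rayleigh_min A : (0 < k)%N -> A^T = A ->
  exists2 a, eigenvalue A a & forall v, a * norm2 v ^+ 2 <= dot v (A *m v).
Proof.
move=> k0 symA.
pose S := [set v : 'rV[R]_k | dot v^T (1%:M *m v^T) = 1].
pose f (v : 'rV[R]_k) := dot v^T (A *m v^T).
have S0 : S !=set0.
  exists (delta_mx 0 (Ordinal k0)).
  rewrite /S /= mul1mx dotE (bigD1 (Ordinal k0))//= big1 => [|i ik].
    by rewrite !mxE eqxx mulr1 addr0.
  by rewrite !mxE (negPf ik) mulr0.
have Sclosed : closed S.
  apply: (preimage_closed (f := fun v : 'rV[R]_k => dot v^T (1%:M *m v^T))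
    (D := [set 1])).
    by move=> v _; exact: continuous_quadratic.
  exact: closed_eq.
have Scompact : compact S.
  have boxc : compact [set v : 'rV[R]_k | forall i, `[(-1 : R), 1]%classic (v ord0 i)].
    apply: (@rV_compact _ _ (fun=> `[(-1 : R), 1]%classic)) => _.
    exact: segment_compact.
  apply: subclosed_compact Sclosed boxc _.
  move=> v; rewrite /S /= mul1mx -norm2_sqr => v1 i.
  have := norm2_coord v^T i; rewrite mxE.
  have -> : norm2 v^T = 1 by apply/eqP; rewrite -(@eqrXn2 _ 2) ?norm2_ge0// v1 expr1n.
  by rewrite ler_norml /= in_itv.
have fcont : {within S, continuous f}.
  by apply: continuous_subspaceT; exact: continuous_quadratic.
have [u uS umin] := EVT_min_rV S0 Scompact fcont.
move: uS; rewrite inE /S /= mul1mx => u1.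
pose a := f u.
have amin v : a * norm2 v ^+ 2 <= dot v (A *m v).
  have [->|vN0] := eqVneq v 0.
    by rewrite norm2_0 expr0n mulr0 mulmx0 /dot mulmx0 mxE.
  have nv0 : 0 < norm2 v by rewrite lt_def norm2_eq0 vN0 norm2_ge0.
  have := umin ((norm2 v)^-1 *: v)^T.
  rewrite -/a inE /S /f /= trmxK mul1mx -scalemxAr !dotZl !dotZr -norm2_sqr.
  have -> : (norm2 v)^-1 * ((norm2 v)^-1 * norm2 v ^+ 2) = 1 by field; rewrite gt_eqF.
  move=> /(_ erefl); rewrite mulrA -expr2 exprVn mulrC ler_pdivlMr ?exprn_gt0//.
exists a => //.
apply/eigenvalueP; exists u; last first.
  apply: contra_eqN u1 => /eqP ->; rewrite trmx0 /dot mulmx0 mxE.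
  by rewrite eq_sym oner_eq0.
apply: trmx_inj; rewrite trmx_mul symA linearZ /=.
apply/eqP; rewrite -subr_eq0; apply/eqP; apply: dot_eq0 => w.
apply: (@linear_term_eq0 _ (dot w (A *m w) - a * norm2 w ^+ 2)) => t.
have := amin (u^T + t *: w).
rewrite !norm2_sqr mulmxDr -scalemxAr !dotDl !dotDr !dotZl !dotZr u1.
rewrite -scaleNr dotZl (dot_mulmx _ u^T w) symA (dotC w (A *m u^T)) (dotC w u^T).
rewrite -[dot u^T (A *m u^T)]/a.
lra.
Qed.

Lemma delta_min_rayleigh A v : (0 < k)%N -> A^T = A ->
  delta_min A * norm2 v ^+ 2 <= dot v (A *m v).
Proof.
move=> k0 symA; have [a ea amin] := symmetric_rayleigh_min k0 symA.
apply: le_trans (amin v); rewrite ler_wpM2r ?sqr_ge0//.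
(* Testing the form on an eigenvector shows that [a] bounds all eigenvalues from below, so the
   infimum is a true one. *)
apply: ge_inf => //; exists a => b /eigenvalueP[u ub uN0].
have := amin u^T; rewrite -{1}symA -trmx_mul ub linearZ /= dotZr norm2_sqr.
rewrite ler_pM2r// -norm2_sqr exprn_gt0// lt_def norm2_ge0 norm2_eq0 andbT.
by rewrite trmx_eq0.
Qed.

Lemma eigenvalueN A a : eigenvalue (- A) (- a) = eigenvalue A a.
Proof.
apply/eigenvalueP/eigenvalueP => -[v va vN0]; exists v => //; move: va.
  by rewrite mulmxN scaleNr => /oppr_inj.
by rewrite mulmxN scaleNr => ->.
Qed.

Lemma delta_max_rayleigh A v : (0 < k)%N -> A^T = A ->
  dot v (A *m v) <= delta_max A * norm2 v ^+ 2.
Proof.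
move=> k0 symA; have := delta_min_rayleigh v k0 (_ : (- A)^T = - A).
rewrite linearN /= symA mulNmx dotNr => /(_ erefl).
rewrite lerNr -mulNr /delta_min /inf opprK.
suff -> : [set - x | x in [set a | eigenvalue (- A) a]] = [set a | eigenvalue A a] by [].
apply/seteqP; split => [_ [x /= ex <-]|x /= ex].
  by rewrite -eigenvalueN opprK.
by exists (- x); rewrite ?opprK//= eigenvalueN.
Qed.

End Rayleigh.

Section Gram.
Context {R : realType} {p : nat} {d : 'I_p -> nat}.
Variables (n : nat) (X : 'I_n -> 'cV[R]_(\sum_(j < p) d j)).

Lemma tr_gram : (gram X)^T = gram X.
Proof.
rewrite /gram linearZ /= linear_sum /=; congr (_ *: _).
by apply: eq_bigr => i _; rewrite trmx_mul trmxK.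
Qed.

Lemma dot_gram h : (0 < n)%N -> design_sqr X h = n%:R * dot h (gram X *m h).
Proof.
move=> n0; rewrite /gram -scalemxAl dotZr mulVKf ?pnatr_eq0 ?gt_eqF// mulmx_suml.
rewrite dotC dot_suml; apply: eq_bigr => i _.
by rewrite -mulmxA [(X i)^T *m h]mx11_scalar mul_mx_scalar dotZl.
Qed.

End Gram.

(** * Measurability *)

Section RationalApproximation.
Context {R : realType} {k : nat}.

Definition ratr_col (q : 'cV[rat]_k) : 'cV[R]_k := map_mx ratr q.

Lemma ratr_col_dense (m : 'cV[R]_k) (e : R) : 0 < e ->
  exists2 q, norm2 (ratr_col q - m) <= e & forall i, m i 0 = 0 -> ratr_col q i 0 = 0.
Proof.
(* Dividing by [k.+1] also covers [k = 0], and [k] squares of this size sum to at most [e ^+ 2]. *)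
move=> e0; have d0 : 0 < e / k.+1%:R by rewrite divr_gt0.
have H i : exists q : rat, `|ratr q - m i 0| <= e / k.+1%:R /\ (m i 0 = 0 -> q = 0).
  have [->|mi] := eqVneq (m i 0) 0.
    by exists 0; rewrite rmorph0 subrr normr0 ltW.
  have : m i 0 < m i 0 + e / k.+1%:R by rewrite ltrDl.
  move=> /rat_in_itvoo[q]; rewrite in_itv /= => /andP[q1 q2].
  exists q; split => [|m0]; last by rewrite m0 eqxx in mi.
  by rewrite ger0_norm ?subr_ge0 ?ltW// ltrBlDl.
pose q : 'cV[rat]_k := \col_i projT1 (cid (H i)).
exists q => [|i mi]; last first.
  rewrite !mxE; case: cid => /= x [_ /(_ mi) ->]; exact: rmorph0.
rewrite -ler_sqr ?nnegrE ?norm2_ge0 ?(ltW e0)// norm2_sqr dotE.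
apply: (@le_trans _ _ (\sum_(i < k) (e / k.+1%:R) ^+ 2)).
  apply: ler_sum => i _; rewrite -expr2 -[leLHS]real_normK ?num_real//.
  rewrite ler_sqr ?nnegrE ?(ltW d0)//.
  by rewrite !mxE; case: cid => /= x [].
rewrite sumr_const card_ord -[_ *+ k]mulr_natl expr_div_n mulrCA ler_piMr ?sqr_ge0//.
rewrite ler_pdivrMr ?exprn_gt0// mul1r -natrX ler_nat.
by rewrite (leq_trans (leqnSn k))// leq_pmulr.
Qed.

End RationalApproximation.

Section MeasurableMinimizer.
Context {disp : measure_display} {T : measurableType disp} {R : realType} {k : nat}.
Variables (F : T -> 'cV[R]_k -> \bar R) (m : T -> 'cV[R]_k) (kappa : R).
Hypothesis kappa0 : 0 < kappa.
Hypothesis F_measurable : forall b, measurable_fun [set: T] (fun w => F w b : \bar R).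
Hypothesis F_fin : forall w, F w (m w) \is a fin_num.
Hypothesis F_gap : forall w (b : 'cV[R]_k),
  (F w (m w) + (kappa * norm2 (b - m w) ^+ 2)%:E <= F w b)%E.
(* [F w] may take the value [+oo]: it is only controlled at points with the
   zeros of the minimizer, and [ratr_col_dense] keeps those zeros. *)
Hypothesis F_lip : forall w, exists C : R, forall b : 'cV[R]_k,
  (forall i, m w i 0 = 0 -> b i 0 = 0) -> norm2 (b - m w) <= 1 ->
  (F w b <= F w (m w) + (C * norm2 (b - m w))%:E)%E.

Let F_approx w (e : R) : 0 < e ->
  exists q, norm2 (ratr_col q - m w) <= e /\ (F w (ratr_col q) <= F w (m w) + e%:E)%E.
Proof.
move=> e0; have [C HC] := F_lip w.
have C1 : 0 < `|C| + 1 by rewrite ltr_wpDl.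
(* The three bounds serve the range of [F_lip], the distance and the value of [F], in this order. *)
have d0 : 0 < Num.min 1 (Num.min e (e / (`|C| + 1))).
  by rewrite !lt_min ltr01 e0 divr_gt0.
have [q + qz] := ratr_col_dense (m w) d0.
rewrite !le_min => /and3P[q1 qe]; rewrite ler_pdivlMr// => qC.
exists q; split => //; apply: le_trans (HC _ qz q1) _.
rewrite leeD2l// lee_fin; apply: le_trans qC; rewrite mulrC ler_wpM2l ?norm2_ge0//.
by rewrite (le_trans (ler_norm C))// lerDl.
Qed.

Lemma measurable_countable_bigcap (U : countType) (A : U -> set T) :
  (forall i, measurable (A i)) -> measurable (\bigcap_i A i).
Proof.
move=> mA; rewrite -[X in measurable X]setCK setC_bigcap; apply: measurableC.
by apply: countable_bigcupT_measurable => // i; exact: measurableC.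
Qed.

(** The event that coordinate [i] is below [t] is written with countable operations: for some margin
    and every tolerance, a rational point whose coordinate is below [t] by that margin is nearly
    minimal among rational points. Quadratic growth turns nearly minimal into near the minimizer. *)
Lemma measurable_minimizer i : measurable_fun [set: T] (fun w => m w i 0).
Proof.
move=> mT; apply: (measurability _ (RGenInftyO.measurableE R)) => //.
move=> _ [_ [t ->] <-]; rewrite setTI.
pose E (l n : nat) (q : 'cV[rat]_k) : set T :=
  if ratr (q i 0) <= t - l.+1%:R^-1 then
    \bigcap_q' [set w | (F w (ratr_col q) <= F w (ratr_col q') + (n.+1%:R^-1)%:E)%E]
  else set0.
rewrite (_ : _ @^-1` _ = \bigcup_l \bigcap_n \bigcup_q E l n q); last first.
  apply/seteqP; split => [w /=|w [l _ H]]; rewrite /= in_itv /=.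
    move=> mt; have tm : 0 < t - m w i 0 by rewrite subr_gt0.
    have [l] : exists l : nat, l.+1%:R^-1 < (t - m w i 0).
      have [l _ /(_ _ (leqnn _))] := near_infty_natSinv_lt (PosNum tm).
      by exists l.
    rewrite -subr_gt0 => tl; exists l => // n _.
    have e0 : 0 < Num.min (t - m w i 0 - l.+1%:R^-1) (n.+1%:R^-1).
      by rewrite lt_min tl invr_gt0 ltr0n.
    have [q [q1 q2]] := F_approx w e0.
    exists q => //; rewrite /E ifT => [q' _ /=|].
      apply: le_trans q2 _; apply: leeD; last by rewrite lee_fin ge_min lexx orbT.
      apply: le_trans (F_gap w _); rewrite leeDl// lee_fin mulr_ge0 ?sqr_ge0// ltW//.
    have := le_trans (norm2_coord (ratr_col q - m w) i) q1.
    rewrite le_min !mxE => /andP[+ _].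
    move/(le_trans (ler_norm _)).
    by move: (ratr (q i 0)) (l.+1%:R^-1) (m w i 0) => x y z; lra.
  (* Otherwise each such [q] is at distance at least [l.+1%:R^-1] from the minimizer, so its excess
     is at least [kappa] times the square of that. The tolerance and the excess of [q'] are each
     held to half of this amount, one of them strictly. *)
  rewrite ltNge; apply/negP => tm.
  have a0 : 0 < kappa * (l.+1%:R^-1) ^+ 2 / 2.
    by rewrite divr_gt0// mulr_gt0// exprn_gt0// invr_gt0.
  have [n na] : exists n : nat, n.+1%:R^-1 < kappa * (l.+1%:R^-1) ^+ 2 / 2.
    by have [n _ /(_ _ (leqnn _))] := near_infty_natSinv_lt (PosNum a0); exists n.
  have [q _] := H n I; rewrite /E; case: ifP => // ql Hq.
  have [q' [_ q'2]] := F_approx w a0.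
  have := le_trans (F_gap w _) (le_trans (Hq q' I) (leeD q'2 (lexx _))).
  rewrite -(fineK (F_fin w)) -!EFinD lee_fin.
  suff : (l.+1%:R^-1) ^+ 2 <= norm2 (ratr_col q - m w) ^+ 2.
    move/(ler_wpM2l (ltW kappa0)); move: na.
    move: (l.+1%:R^-1 ^+ 2 : R) (n.+1%:R^-1 : R) => x y H1 H2.
    by apply/negP; rewrite -ltNge; lra.
  rewrite ler_sqr ?nnegrE ?norm2_ge0// (le_trans _ (norm2_coord _ i))// !mxE.
  rewrite distrC (le_trans _ (ler_norm _))//; move: ql.
  by move: tm; move: (ratr (q i 0)) (l.+1%:R^-1) (m w i 0) => x y z; lra.
apply: bigcup_measurable => l _; apply: bigcap_measurableType => n _.
apply: countable_bigcupT_measurable => // q; rewrite /E; case: ifP => // _.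
apply: measurable_countable_bigcap => q'; rewrite -[X in measurable X]setTI.
apply: measurable_lee => //.
by apply: emeasurable_funD => //; exact: measurable_cst.
Qed.

End MeasurableMinimizer.

Section MeasurableSelection.
Context {disp : measure_display} {T : measurableType disp} {R : realType}.

Lemma measurable_natr_bool d' (U : measurableType d') (b : U -> bool) :
  measurable_fun [set: U] b -> measurable_fun [set: U] (fun u => (b u)%:R : R).
Proof.
move=> mb; rewrite (_ : (fun u => _) = fun u => if b u then 1 else 0).
  exact: measurable_fun_ifT.
by apply/funext => u; case: (b u).
Qed.

Lemma measurable_rho (tau : R) : measurable_fun [set: R] (rho tau).
Proof.
apply: measurable_funM; first exact: measurable_funX.
apply: measurableT_comp => //; apply: measurable_funB => //.
by apply: measurable_natr_bool; exact: measurable_fun_ltr.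
Qed.

Lemma measurable_g_tau (tau : R) : measurable_fun [set: R] (g_tau tau).
Proof.
apply: measurable_funM; first exact: measurable_funM.
apply: measurable_funD; apply: measurable_funM => //.
  by apply: measurable_natr_bool; exact: measurable_fun_ler.
by apply: measurable_natr_bool; exact: measurable_fun_ltr.
Qed.

Lemma measurable_norm2 k (v : T -> 'cV[R]_k) :
  (forall i, measurable_fun [set: T] (fun w => v w i 0)) ->
  measurable_fun [set: T] (fun w => norm2 (v w)).
Proof.
move=> mv; apply: (measurableT_comp (f := @Num.sqrt R)).
  by apply: continuous_measurable_fun => x; exact: sqrt_continuous.
by apply: measurable_sum => i; exact: measurable_funX.
Qed.

Context {p : nat} {d : 'I_p -> nat}.
Local Notation vec := ('cV[R]_(\sum_(j < p) d j)).

Lemma measurable_norm2_block (v : T -> vec) j :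
  (forall i, measurable_fun [set: T] (fun w => v w i 0)) ->
  measurable_fun [set: T] (fun w => norm2 (submxcol (v w) j)).
Proof.
move=> mv; apply: measurable_norm2 => i.
rewrite (_ : (fun w => _) = fun w => v w (tagnat.Rank j i) 0)//.
by apply/funext => w; rewrite mxE.
Qed.

Variables (n : nat) (X : 'I_n -> vec) (tau kappa : R).
Hypotheses (htau : 0 < tau < 1) (hk : kappa <= tau) (hk' : kappa <= 1 - tau).
Hypothesis kappa0 : 0 < kappa.

(** Convexity at [b] in the direction of [m] bounds the increase by the score at [b], which is close
    to the score at [m]; within distance [1] the quadratic remainder is linear. *)
Lemma expectile_loss_lip (B : R) (Y : 'I_n -> R) (m : vec) :
  (forall h, design_sqr X h <= B * norm2 h ^+ 2) ->
  exists C : R, forall b, norm2 (b - m) <= 1 ->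
    expectile_loss X tau Y b <= expectile_loss X tau Y m + C * norm2 (b - m).
Proof.
move=> hB; exists (norm2 (score X tau Y m) + 2 * `|B|) => b b1.
have := expectile_loss_lower X htau hk hk' Y b (m - b); rewrite subrKC.
have := mulr_ge0 (ltW kappa0) (design_sqr_ge0 X (m - b)).
have := score_lipschitz htau Y b m (m - b) hB; rewrite ler_norml => /andP[+ _].
have := ler_norm2_dot (score X tau Y m) (m - b); rewrite ler_norml => /andP[+ _].
rewrite -(norm2N (m - b)) opprB.
have : B * norm2 (b - m) * norm2 (b - m) <= `|B| * norm2 (b - m).
  apply: (@le_trans _ _ (`|B| * norm2 (b - m) * norm2 (b - m))).
    by rewrite -!mulrA ler_wpM2r ?mulr_ge0 ?norm2_ge0 ?ler_norm.
  by rewrite ler_piMr// mulr_ge0 ?norm2_ge0.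
lra.
Qed.

Variables (m0 M0 : R).
Hypotheses (n0 : (0 < n)%N) (hm0 : 0 < m0).
Hypothesis hlow : forall h, m0 * n%:R * norm2 h ^+ 2 <= design_sqr X h.
Hypothesis hup : forall h, design_sqr X h <= M0 * n%:R * norm2 h ^+ 2.

Variable Y : T -> 'I_n -> R.
Hypothesis mY : forall i, measurable_fun [set: T] (fun w => Y w i).

Let nR0 : 0 < n%:R :> R. Proof. by rewrite ltr0n. Qed.

Lemma measurable_expectile_loss b :
  measurable_fun [set: T] (fun w => expectile_loss X tau (Y w) b).
Proof.
apply: measurable_sum => i; apply: measurableT_comp; first exact: measurable_rho.
exact: measurable_funB.
Qed.

Lemma measurable_expectile (bt : T -> vec) :
  (forall w, is_argmin (expectile_loss X tau (Y w)) (bt w)) ->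
  forall i, measurable_fun [set: T] (fun w => bt w i 0).
Proof.
move=> hbt; apply: (@measurable_minimizer _ _ _ _
    (fun w b => (expectile_loss X tau (Y w) b)%:E) _ (kappa / 2 * (m0 * n%:R))).
- by rewrite mulr_gt0// ?mulr_gt0// divr_gt0.
- by move=> b; apply/measurable_EFinP; exact: measurable_expectile_loss.
- by [].
- move=> w b; rewrite -EFinD lee_fin.
  apply: le_trans (expectile_argmin_gap htau hk hk' b (hbt w)).
  by rewrite lerD2l -mulrA ler_pM2l ?divr_gt0.
- move=> w; have [C HC] := expectile_loss_lip (Y w) (bt w) hup.
  by exists C => b _ b1; rewrite -EFinD lee_fin; exact: HC.
Qed.

Variables (gamma lambda : R).
Hypothesis lambda0 : 0 < lambda.

Lemma measurable_lasso_objective (bt : T -> vec) b :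
  (forall i, measurable_fun [set: T] (fun w => bt w i 0)) ->
  measurable_fun [set: T]
    (fun w => lasso_objective X tau gamma lambda (Y w) (bt w) b : \bar R).
Proof.
move=> mbt; apply: emeasurable_funD.
  apply/measurable_EFinP; apply: measurable_funM => //.
  exact: measurable_expectile_loss.
apply: emeasurable_funM; first exact: measurable_cst.
apply: emeasurable_sum => j; apply: emeasurable_funM; last exact: measurable_cst.
apply: measurable_fun_ifT.
- by apply: measurable_fun_eqr => //; exact: measurable_norm2_block.
- exact: measurable_cst.
- apply/measurable_EFinP; apply: (measurableT_comp (measurable_powR _)).
  exact: measurable_norm2_block.
Qed.

(** The zero vector meets every zero constraint, so the minimum is finite. *)
Lemma lasso_objective_fin (Y' : 'I_n -> R) (bt m : vec) :
  is_argmin (lasso_objective X tau gamma lambda Y' bt) m ->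
  lasso_objective X tau gamma lambda Y' bt m \is a fin_num.
Proof.
move=> /(_ 0); rewrite !lasso_objectiveE//; case: ifP => // _.
case: ifP => // /forallP; case => j; apply/implyP => _.
by rewrite submxcol0 norm2_0.
Qed.

Lemma lasso_objective_lip (Y' : 'I_n -> R) (bt m : vec) :
  exists C : R, forall b : vec,
    (forall i, m i 0 = 0 -> b i 0 = 0) -> norm2 (b - m) <= 1 ->
    (lasso_objective X tau gamma lambda Y' bt b <=
     lasso_objective X tau gamma lambda Y' bt m + (C * norm2 (b - m))%:E)%E.
Proof.
have [C HC] := expectile_loss_lip Y' m hup.
exists (n%:R^-1 * C + lambda * \sum_j norm2 (submxcol bt j) `^ (- gamma)) => b bz b1.
rewrite !lasso_objectiveE//.
case: (ifP [forall j, _ ==> (norm2 (submxcol m j) == 0)]) => [cm|_]; last first.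
  by rewrite addye// leey.
rewrite ifT; last first.
  apply/forallP => j; apply/implyP => btj.
  move/forallP : cm => /(_ j) /implyP /(_ btj); rewrite !norm2_eq0 => /eqP mj.
  apply/eqP/colP => i; rewrite !mxE; apply: bz.
  by move/colP/(_ i) : mj; rewrite !mxE.
rewrite -EFinD lee_fin /lasso_real.
have : \sum_j norm2 (submxcol bt j) `^ (- gamma) * norm2 (submxcol b j) <=
    \sum_j norm2 (submxcol bt j) `^ (- gamma) * norm2 (submxcol m j) +
    (\sum_j norm2 (submxcol bt j) `^ (- gamma)) * norm2 (b - m).
  rewrite mulr_suml -big_split /=; apply: ler_sum => j _.
  rewrite -mulrDr ler_wpM2l ?powR_ge0//.
  have := norm2D (submxcol m j) (submxcol b j - submxcol m j); rewrite subrKC.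
  by move/le_trans; apply; rewrite lerD2l -submxcolB norm2_block_le.
move/(ler_wpM2l (ltW lambda0)).
have := ler_wpM2l (_ : 0 <= n%:R^-1) (HC b b1).
rewrite invr_ge0 ler0n => /(_ isT); lra.
Qed.

Lemma measurable_lasso (bt bh : T -> vec) :
  (forall i, measurable_fun [set: T] (fun w => bt w i 0)) ->
  (forall w, is_argmin (lasso_objective X tau gamma lambda (Y w) (bt w)) (bh w)) ->
  forall i, measurable_fun [set: T] (fun w => bh w i 0).
Proof.
move=> mbt hbh; apply: (@measurable_minimizer _ _ _ _
    (fun w b => lasso_objective X tau gamma lambda (Y w) (bt w) b) _
    (kappa / 2 * m0)).
- by rewrite mulr_gt0// divr_gt0.
- by move=> b; exact: measurable_lasso_objective.
- by move=> w; exact: lasso_objective_fin.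
- move=> w b; apply: le_trans (lasso_argmin_gap htau hk hk' b lambda0 (hbh w)).
  rewrite leeD2l// lee_fin -mulrA [leRHS]mulrCA ler_pM2l ?divr_gt0//.
  by rewrite ler_pdivlMl// mulrCA mulrA hlow.
- by move=> w; exact: lasso_objective_lip.
Qed.

Lemma measurable_active (b : T -> vec) (A : {set 'I_p}) :
  (forall i, measurable_fun [set: T] (fun w => b w i 0)) ->
  measurable [set w | active (b w) = A].
Proof.
move=> mb.
rewrite (_ : [set w | _] =
    \bigcap_j [set w | (norm2 (submxcol (b w) j) == 0) = (j \notin A)]); last first.
  apply/seteqP; split => [w /= <- j _ /=|w H]; first by rewrite inE negbK.
  by apply/setP => j; rewrite inE (H j I) negbK.
apply: fin_bigcap_measurable => [|j _]; first exact: finite_finset.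
have := measurable_fun_eqr (measurable_norm2_block j mb) (measurable_cst (0 : R)).
by move=> /(_ measurableT [set (j \notin A)] I); rewrite setTI.
Qed.

End MeasurableSelection.

(** * Second moment of the score *)

Section Uncorrelated.
Context {disp : measure_display} {T : measurableType disp} {R : realType}.
Variable P : probability T R.

(** The product rule on rectangles identifies the law of the pair with the product of the laws; in
    Fubini's iterated integral the inner one is [f x] times a zero mean. *)
Lemma integral_mul_indep (X1 X2 : {RV P >-> R}) (f : R -> R) :
  measurable_fun [set: R] f ->
  (forall B1 B2 : set R, measurable B1 -> measurable B2 ->
    P ((X1 @^-1` B1) `&` (X2 @^-1` B2)) = (P (X1 @^-1` B1) * P (X2 @^-1` B2))%E) ->
  P.-integrable [set: T] (fun w => (f (X1 w) * f (X2 w))%:E) ->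
  P.-integrable [set: T] (fun w => (f (X2 w))%:E) ->
  (\int[P]_w (f (X2 w))%:E = 0)%E ->
  (\int[P]_w (f (X1 w) * f (X2 w))%:E = 0)%E.
Proof.
move=> mf ind int12 int2 f20.
pose phi w := (X1 w, X2 w).
have mphi : measurable_fun [set: T] phi by apply/measurable_fun_pairP; split.
pose mixphi := isMeasurableFun.Build _ _ _ _ phi mphi.
pose Phi : {mfun T >-> (R * R)%type} := HB.pack phi mixphi.
pose m1 := distribution P X1; pose m2 := distribution P X2.
pose h (z : R * R) := (f z.1 * f z.2)%:E.
have mh : measurable_fun [set: R * R] h.
  by apply/measurable_EFinP; apply: measurable_funM; apply: measurableT_comp.
have m12 A : measurable A -> (m1 \x m2)%E A = distribution P Phi A.
  apply: product_measure_unique => B1 B2 mB1 mB2.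
  rewrite -[LHS]/(P (Phi @^-1` (B1 `*` B2))) -[RHS]/(P (X1 @^-1` B1) * P (X2 @^-1` B2))%E.
  by rewrite -ind.
have inth : (distribution P Phi).-integrable [set: R * R] h.
  by apply: integrable_pushforward.
have inth' : (m1 \x m2)%E.-integrable [set: R * R] h.
  move/integrableP : inth => [_ H]; apply/integrableP; split => //.
  rewrite (eq_measure_integral (distribution P Phi)) => [|A mA _]; first exact: H.
  exact: m12.
have -> : (\int[P]_w (f (X1 w) * f (X2 w))%:E = \int[distribution P Phi]_z h z)%E.
  by rewrite integral_distribution.
rewrite (eq_measure_integral (m1 \x m2)%E) => [|A mA _]; last exact/esym/m12.
rewrite -integral12_prod_meas1// /fubini_F.
have int2' : m2.-integrable [set: R] (fun y => (f y)%:E).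
  by apply: integrable_pushforward => //; exact/measurable_EFinP.
rewrite (eq_integral (cst 0%E)) ?integral_cst ?mul0e// => x _ /=.
rewrite (eq_integral (fun y => (f x)%:E * (f y)%:E)%E) => [|y _]; last by rewrite -EFinM.
rewrite integralZl//.
rewrite (_ : (\int[m2]_y (f y)%:E)%E = 0%E) ?mule0//.
by rewrite integral_distribution// -?f20//; exact/measurable_EFinP.
Qed.

Lemma integral_sqr_sum (n : nat) (Z : 'I_n -> T -> R) (a : 'I_n -> R) (v : R) :
  (forall i j, P.-integrable [set: T] (fun w => (Z i w * Z j w)%:E)) ->
  (forall i j, \int[P]_w (Z i w * Z j w)%:E = (if i == j then v else 0)%:E)%E ->
  (\int[P]_w ((\sum_i a i * Z i w) ^+ 2)%:E = (\sum_i a i ^+ 2 * v)%:E)%E /\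
  P.-integrable [set: T] (fun w => ((\sum_i a i * Z i w) ^+ 2)%:E).
Proof.
move=> intZ covZ.
have E w : (((\sum_i a i * Z i w) ^+ 2)%:E =
    \sum_i \sum_j (a i * a j)%:E * (Z i w * Z j w)%:E)%E.
  rewrite expr2 mulr_suml -sumEFin; apply: eq_bigr => i _.
  rewrite mulr_sumr -sumEFin; apply: eq_bigr => j _.
  by rewrite -EFinM; congr EFin; ring.
have int2 i j : P.-integrable [set: T] (fun w => (a i * a j)%:E * (Z i w * Z j w)%:E)%E.
  exact: integrableZl.
have int1 i : P.-integrable [set: T]
    (fun w => \sum_j (a i * a j)%:E * (Z i w * Z j w)%:E)%E.
  by apply: integrable_sum.
split; last first.
  by rewrite (_ : (fun w => _) = fun w =>
      (\sum_i \sum_j (a i * a j)%:E * (Z i w * Z j w)%:E)%E);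
    [exact: integrable_sum|apply/funext].
under eq_integral do rewrite E.
rewrite integral_sum// -sumEFin; apply: eq_bigr => i _.
rewrite integral_sum// (bigD1 i)//= big1 => [|j ij].
  by rewrite integralZl// covZ eqxx adde0 -EFinM expr2.
by rewrite integralZl// covZ eq_sym (negPf ij) mule0.
Qed.

Lemma markov_ge0 (V : T -> R) (t : R) : 0 < t -> (forall w, 0 <= V w) ->
  measurable_fun [set: T] V ->
  (t%:E * P [set w | (t <= V w)%R] <= \int[P]_w (V w)%:E)%E.
Proof.
move=> t0 V0 mV.
have -> : [set w | (t <= V w)%R] = setT `&` [set w | (t%:E <= `|(EFin \o V) w|)%E].
  by rewrite setTI; apply/seteqP; split => w /=; rewrite lee_fin ger0_norm.
have -> : (\int[P]_w (V w)%:E = \int[P]_w `|(EFin \o V) w|)%E.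
  by apply: eq_integral => w _ /=; rewrite ger0_norm.
apply: (@le_integral_comp_abse _ _ _ P _ measurableT (EFin \o V) t idfun) => //.
  exact: measurable_id.
exact/measurable_EFinP.
Qed.

End Uncorrelated.

Section Score.
Context {disp : measure_display} {T : measurableType disp} {R : realType}.
Variables (P : probability T R) (eps : nat -> {RV P >-> R}) (tau : R).
Hypothesis htau : 0 < tau < 1.
Hypothesis hindep : mutually_independent eps.
Hypothesis hident : identically_distributed eps.
Hypothesis hexpectile : forall i : nat, 'E_P[g_tau tau \o eps i]%E = 0%E.
Hypothesis hmoment : forall i : nat, ('E_P[fun w : T => (eps i w ^+ 4)%R] < +oo)%E.

Let Z i w := g_tau tau (eps i w).

Let mZ i : measurable_fun [set: T] (Z i).
Proof. by apply: measurableT_comp => //; exact: measurable_g_tau. Qed.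

(** From [|Z| <= 2 |eps|] and the square of [eps ^+ 2 - 1]. The fourth moment thus yields an
    integrable majorant for every product of two [Z]. *)
Let Z_bound i w : Z i w ^+ 2 <= 2 + 2 * eps i w ^+ 4.
Proof.
have := g_tau_lipschitz htau (eps i w) 0.
rewrite {2}/g_tau mulr0 mul0r !subr0 -/(Z i w) => H.
have : `|Z i w| ^+ 2 <= (2 * `|eps i w|) ^+ 2.
  by rewrite ler_sqr ?nnegrE// mulr_ge0.
rewrite exprMn !real_normK ?num_real// => {}H; apply: le_trans H _.
have -> : eps i w ^+ 4 = (eps i w ^+ 2) ^+ 2 by rewrite -exprM.
have := sqr_ge0 (eps i w ^+ 2 - 1); lra.
Qed.

Let int_eps4 i : P.-integrable [set: T] (fun w => (eps i w ^+ 4)%:E).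
Proof.
apply/integrableP; split.
  by apply/measurable_EFinP; exact: measurable_funX.
have := hmoment i; rewrite unlock; apply: le_lt_trans; rewrite le_eqVlt.
apply/orP; left; apply/eqP; apply: eq_integral => w _ /=.
by rewrite ger0_norm// (exprM _ 2 2) sqr_ge0.
Qed.

Let int_dom i : P.-integrable [set: T] (fun w => (2 + 2 * eps i w ^+ 4)%:E).
Proof.
have := integrableD measurableT (finite_measure_integrable_cst P 2 measurableT)
  (integrableZl measurableT 2 (int_eps4 i)).
by apply: eq_integrable.
Qed.

Let int_ZZ i j : P.-integrable [set: T] (fun w => (Z i w * Z j w)%:E).
Proof.
apply: le_integrable (integrableD measurableT (int_dom i) (int_dom j)) => //.
  by apply/measurable_EFinP; exact: measurable_funM.
move=> w _ /=; rewrite lee_fin [leRHS]ger0_norm.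
  have := Z_bound i w; have := Z_bound j w.
  have := sqr_ge0 (Z i w - Z j w); have := sqr_ge0 (Z i w + Z j w).
  rewrite ler_norml; move=> H1 H2 H3 H4; apply/andP; split; nra.
by rewrite addr_ge0// (le_trans (sqr_ge0 _) (Z_bound _ _)).
Qed.

Let int_Z i : P.-integrable [set: T] (fun w => (Z i w)%:E).
Proof.
apply: le_integrable (integrableD measurableT
  (finite_measure_integrable_cst P 1 measurableT) (int_dom i)) => //.
  exact/measurable_EFinP.
move=> w _ /=; rewrite lee_fin [leRHS]ger0_norm.
  have := Z_bound i w.
  have := sqr_ge0 (Z i w - 1); have := sqr_ge0 (Z i w + 1).
  rewrite ler_norml; move=> H1 H2 H3; apply/andP; split; nra.
by rewrite addr_ge0// (le_trans (sqr_ge0 _) (Z_bound _ _)).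
Qed.

Let v := fine (\int[P]_w (Z 0 w * Z 0 w)%:E)%E.

Let cov_Z i j : (\int[P]_w (Z i w * Z j w)%:E = (if i == j then v else 0)%:E)%E.
Proof.
case: eqVneq => [<-|ij].
  rewrite fineK ?integrable_fin_num//.
  pose h (x : R) := (g_tau tau x * g_tau tau x)%:E.
  have mh : measurable_fun [set: R] h.
    by apply/measurable_EFinP; apply: measurable_funM; exact: measurable_g_tau.
  have h0 x : (0 <= h x)%E by rewrite lee_fin -expr2 sqr_ge0.
  rewrite -[LHS](ge0_integral_distribution (eps i) mh h0).
  rewrite -[RHS](ge0_integral_distribution (eps 0) mh h0).
  by apply: eq_measure_integral => A mA _; exact: hident.
apply: (integral_mul_indep (X1 := eps i) (X2 := eps j)) => //.
- exact: measurable_g_tau.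
- move=> B1 B2 mB1 mB2.
  pose B k := if k == i then B1 else B2.
  have mB k : measurable (B k) by rewrite /B; case: ifP.
  have := @hindep [fset i; j]%fset B mB.
  rewrite big_fsetU1 ?inE//= big_seq_fset1 /B eqxx eq_sym (negPf ij) => <-.
  congr (P _); apply/seteqP; split => [w [/= wi wj] k /=|w H /=].
    by rewrite !inE => /orP[/eqP ->|/eqP ->]; rewrite ?eqxx// eq_sym (negPf ij).
  split; first by have := H i; rewrite /= !inE eqxx /=; apply.
  by have := H j; rewrite /= !inE eqxx orbT eq_sym (negPf ij) /=; apply.
- exact: int_ZZ.
- exact: int_Z.
- by have := hexpectile j; rewrite unlock.
Qed.

(** At the true parameter the residuals are the errors, so each coordinate of the score is a
    combination of uncorrelated variables with variance [v]. The constant is chosen before the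
    design, hence is the same for all [n]. *)
Lemma score_second_moment : exists2 v : R, 0 <= v &
  forall (p : nat) (d : 'I_p -> nat) (n : nat)
    (X : 'I_n -> 'cV[R]_(\sum_(j < p) d j)) (b0 : 'cV[R]_(\sum_(j < p) d j)),
  let S w := score X tau (response X b0 (fun i : 'I_n => eps i w)) b0 in
  (forall k, measurable_fun [set: T] (fun w => S w k 0)) /\
  (\int[P]_w (norm2 (S w) ^+ 2)%:E = (v * \sum_i norm2 (X i) ^+ 2)%:E)%E.
Proof.
exists v => [|p d n X b0 S].
  by apply: fine_ge0; apply: integral_ge0 => w _; rewrite lee_fin -expr2 sqr_ge0.
have SE w k : S w k 0 = \sum_i X i k 0 * Z i w.
  rewrite /S /score summxE; apply: eq_bigr => i _.
  by rewrite mxE mulrC /response addrC addKr.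
split=> [k|].
  rewrite (_ : (fun w => _) = fun w => \sum_i X i k 0 * Z i w); last exact/funext.
  by apply: measurable_sum => i; exact: measurable_funM.
have H k := @integral_sqr_sum _ T R P n (fun i => Z i) (fun i => X i k 0) v
  (fun i j => int_ZZ i j) (fun i j => cov_Z i j).
under eq_integral do rewrite norm2_sqr dotE -sumEFin.
rewrite integral_sum//=; last first.
  move=> k; have [_] := H k; apply: eq_integrable => // w _.
  by rewrite SE -expr2.
transitivity (\sum_k (\sum_i X i k 0 ^+ 2 * v)%:E)%E.
  apply: eq_bigr => k _; have [<- _] := H k.
  by apply: eq_integral => w _; rewrite SE -expr2.
rewrite sumEFin; congr EFin; rewrite exchange_big mulr_sumr; apply: eq_bigr => i _ /=.
rewrite norm2_sqr dotE mulr_sumr; apply: eq_bigr => k _.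
by rewrite mulrC expr2.
Qed.

End Score.

(** * Rates of convergence *)

Section Rates.
Context {R : realType}.

Lemma powRDp (x a b : R) : 0 < x -> x `^ (a + b) = x `^ a * x `^ b.
Proof. by move=> x0; rewrite powRD// (gt_eqF x0) implybT. Qed.

Lemma powR_ge_near (a B : R) : 0 < a -> \forall n \near \oo, B <= n%:R `^ a.
Proof.
move=> a0; pose b := Num.max B 0 `^ a^-1.
near=> n; apply: (@le_trans _ _ (b `^ a)).
  rewrite /b -powRrM mulVf ?gt_eqF// powRr1 ?le_max ?lexx ?orbT//.
apply: ge0_ler_powR; rewrite ?nnegrE ?powR_ge0 ?(ltW a0)//.
by near: n; exact: nbhs_infty_ger.
Unshelve. all: by end_near. Qed.

Lemma bigO_powR_near (u : nat -> nat) (c : R) :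
  (fun n => (u n)%:R : R^o) =O_\oo (fun n => n%:R `^ c : R^o) ->
  exists2 C : R, 0 < C & \forall n \near \oo, (u n)%:R <= C * n%:R `^ c.
Proof.
move=> /eqO_exP[C C0 H]; exists C => //.
by apply: filterS H => n /=; rewrite !ger0_norm// powR_ge0.
Qed.

(** Exponent bookkeeping with [x = n]: these rewrite the score threshold, the signal and the two
    penalty conditions so that, in the last three, a factor [rho] cancels and the assumed limits
    appear. *)
Lemma rates (x c alpha gamma K a : R) : 0 < x -> 0 < K -> 0 < a ->
  let rho := x `^ ((c - 1) / 2) in
  [/\ (x * rho) ^+ 2 = x * x `^ c,
      x `^ alpha = x `^ (alpha - (c - 1) / 2) * rho,
      (K * x `^ alpha / 2) `^ (- gamma) * x `^ (c / 2) =
        (K / 2) `^ (- gamma) * (x `^ (2^-1 - alpha * gamma) * rho) &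
      (a * rho) `^ (- gamma) = a `^ (- gamma) * (x `^ ((1 - c) * (1 + gamma) / 2) * rho)].
Proof.
move=> x0 K0 a0 rho; have x0' := ltW x0; split.
- rewrite -{1}(powRr1 x0') -(powRDp _ _ x0) -powR_mulrn ?powR_ge0// -powRrM.
  rewrite -{2}(powRr1 x0') -(powRDp _ _ x0); congr (_ `^ _); lra.
- by rewrite -powRDp//; congr (_ `^ _); lra.
- rewrite (mulrAC K) (@powRM _ (K / 2) (x `^ alpha)) ?powR_ge0 ?divr_ge0 ?(ltW K0)//.
  rewrite -mulrA; congr (_ * _).
  by rewrite -powRrM -!powRDp//; congr (_ `^ _); lra.
- rewrite powRM ?powR_ge0 ?(ltW a0)//; congr (_ * _).
  by rewrite -powRrM -powRDp//; congr (_ `^ _); lra.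
Qed.

End Rates.

Section Bounds.
Context {R : realType}.

Lemma norm2_le_mx_norm k (v : 'cV[R]_k) (C : R) :
  mx_norm v <= C -> norm2 v ^+ 2 <= k%:R * C ^+ 2.
Proof.
move=> vC; rewrite norm2_sqr dotE.
apply: (@le_trans _ _ (\sum_(i < k) C ^+ 2)); last first.
  by rewrite sumr_const card_ord -[_ *+ k]mulr_natl.
apply: ler_sum => i _; rewrite -expr2 -[leLHS]real_normK ?num_real//.
have vi : `|v i 0| <= mx_norm v.
  by rewrite mx_normrE; apply/bigmax_geP; right => /=; exists (i, 0).
have C0 : 0 <= C by rewrite (le_trans _ (le_trans vi vC)).
by rewrite ler_sqr ?nnegrE// (le_trans vi).
Qed.

Lemma min_signal_le (p : nat) (d : 'I_p -> nat) p0
    (b : 'cV[R]_(\sum_(j < p) d j)) (K x : R) :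
  0 < x -> (K%:E <= (x^-1)%:E * min_signal p0 b)%E ->
  forall j : 'I_p, (j < p0)%N -> K * x <= norm2 (submxcol b j).
Proof.
move=> x0 H j jp.
have le : (min_signal p0 b <= (norm2 (submxcol b j))%:E)%E.
  by rewrite /min_signal; apply: (@bigmin_inf _ _ _ _ j).
have := le_trans H (lee_wpmul2l _ le); rewrite lee_fin invr_ge0 ltW// => /(_ isT).
by rewrite -EFinM lee_fin ler_pdivlMl// mulrC.
Qed.

End Bounds.

(** * Probability of correct selection *)

Section SelectionProbability.
Context {disp : measure_display} {T : measurableType disp} {R : realType}.
Variables (P : probability T R) (p : nat) (d : 'I_p -> nat) (n : nat).
Local Notation vec := ('cV[R]_(\sum_(j < p) d j)).
Variables (X : 'I_n -> vec) (tau kappa gamma lambda m0 M0 s t eta e : R).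
Variables (b0 : vec) (Y : T -> 'I_n -> R) (bt bh : T -> vec).
Hypotheses (htau : 0 < tau < 1) (hk : kappa <= tau) (hk' : kappa <= 1 - tau).
Hypotheses (n0 : (0 < n)%N) (kappa0 : 0 < kappa) (gamma0 : 0 <= gamma)
  (lambda0 : 0 < lambda) (hm0 : 0 < m0) (s0 : 0 < s).
Hypothesis hlow : forall h, m0 * n%:R * norm2 h ^+ 2 <= design_sqr X h.
Hypothesis hup : forall h, design_sqr X h <= M0 * n%:R * norm2 h ^+ 2.
Hypothesis heta :
  forall j, norm2 (submxcol b0 j) != 0 -> eta <= norm2 (submxcol b0 j).
Hypothesis tE : t = s / (kappa * m0).
Hypothesis ht : 2 * t < eta.
Hypothesis hlambda_small : lambda * (eta / 2) `^ (- gamma) * Num.sqrt p%:R <= s.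
Hypothesis hlambda_large : s + 4 * M0 * t < lambda * t `^ (- gamma).
Hypothesis mY : forall i, measurable_fun [set: T] (fun w => Y w i).
Hypothesis hbt : forall w, is_argmin (expectile_loss X tau (Y w)) (bt w).
Hypothesis hbh : forall w,
  is_argmin (lasso_objective X tau gamma lambda (Y w) (bt w)) (bh w).
Let S w := score X tau (Y w) b0.
Hypothesis mS : forall k, measurable_fun [set: T] (fun w => S w k 0).
Hypothesis intS : (\int[P]_w (norm2 (S w) ^+ 2)%:E <= (e * (n%:R * s) ^+ 2)%:E)%E.

(** Markov's inequality for the squared norm of the score leaves probability at most [e] for
    exceeding the threshold [n s]; elsewhere the deterministic selection applies. *)
Lemma selection_probability :
  measurable [set w | active (bh w) = active b0] /\
  ((1 - e)%:E <= P [set w | active (bh w) = active b0])%E.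
Proof.
have mE : measurable [set w | active (bh w) = active b0].
  apply: measurable_active.
  have mbt := measurable_expectile htau hk hk' kappa0 n0 hm0 hlow hup mY hbt.
  exact: (measurable_lasso htau hk hk' kappa0 n0 hm0 hlow hup mY lambda0 mbt hbh).
split => //.
have t0 : 0 < (n%:R * s) ^+ 2 by rewrite exprn_gt0// mulr_gt0// ltr0n.
have mS2 : measurable_fun [set: T] (fun w => norm2 (S w) ^+ 2).
  by apply: measurable_funX; exact: measurable_norm2.
pose A := [set w | (n%:R * s) ^+ 2 <= norm2 (S w) ^+ 2].
have mA : measurable A.
  rewrite -[A]setTI; have := measurable_fun_ler (measurable_cst ((n%:R * s) ^+ 2)) mS2.
  move=> /(_ measurableT [set true] I); rewrite (_ : _ @^-1` _ = A)//.
have PA : (P A <= e%:E)%E.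
  have := le_trans (markov_ge0 P t0 (fun w => sqr_ge0 _) mS2) intS.
  rewrite -/A -[P A]fineK ?fin_num_measure// -EFinM !lee_fin.
  by rewrite [e * _]mulrC ler_pM2l.
have PAC : ((1 - e)%:E <= P (~` A))%E.
  by rewrite probability_setC// EFinB leeB.
apply: le_trans PAC _; apply: le_measure; rewrite ?inE//; first exact: measurableC.
move=> w /negP; rewrite -ltNge ltr_sqr ?nnegrE ?norm2_ge0 ?mulr_ge0 ?(ltW s0)//.
move=> /ltW hS.
exact: (lasso_selection htau hk hk' n0 kappa0 gamma0 lambda0 hm0 s0 hlow hup hS
  heta tE ht hlambda_small hlambda_large (hbt w) (hbh w)).
Qed.

End SelectionProbability.

(** * Choice of constants and passage to the limit *)

Theorem theorem3p4
  (R : realType) (disp : measure_display) (T : measurableType disp)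
  (P : probability T R)
  (* model *)
  (p p0 : nat -> nat) (d : forall n : nat, 'I_(p n) -> nat)
  (X : forall n : nat, 'I_n -> 'cV[R]_(\sum_(j < p n) d n j))
  (beta0 : forall n : nat, 'cV[R]_(\sum_(j < p n) d n j))
  (eps : nat -> {RV P >-> R})
  (hd : forall (n : nat) (j : 'I_(p n)), (0 < d n j)%N)
  (hp0 : forall n : nat, (p0 n <= p n)%N)
  (hbeta0 : forall (n : nat) (j : 'I_(p n)),
     norm2 (submxcol (beta0 n) j) != 0 <-> (j < p0 n)%N)
  (* estimators *)
  (tau gamma : R) (htau : 0 < tau < 1) (hgamma : 0 < gamma)
  (lambda : nat -> R) (hlambda : forall n : nat, 0 < lambda n)
  (betat betah : forall n : nat, T -> 'cV[R]_(\sum_(j < p n) d n j))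
  (hbetat : forall (n : nat) (w : T),
     is_argmin
       (expectile_loss (X n) tau
          (response (X n) (beta0 n) (fun i : 'I_n => eps i w)))
       (betat n w))
  (hbetah : forall (n : nat) (w : T),
     is_argmin
       (lasso_objective (X n) tau gamma (lambda n)
          (response (X n) (beta0 n) (fun i : 'I_n => eps i w)) (betat n w))
       (betah n w))
  (* (A1) *)
  (hindep : mutually_independent eps)
  (hident : identically_distributed eps)
  (hexpectile : forall i : nat, 'E_P[g_tau tau \o eps i]%E = 0%E)
  (hdensity : exists f : R -> R,
     [/\ forall i : nat, has_density (eps i) f,
         forall x : R, 0 < f x &
         \forall x \near (0 : R), {for x, continuous f}])
  (hmoment : forall i : nat, ('E_P[fun w : T => (eps i w ^+ 4)%R] < +oo)%E)
  (* (A2) *)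
  (C0 : R) (hC0 : 0 < C0)
  (hA2 : \forall n \near \oo, forall i : 'I_n, mx_norm (X n i) <= C0)
  (* (A3) *)
  (m0 M0 : R) (hm0 : 0 < m0) (hm0M0 : m0 <= M0)
  (hA3 : \forall n \near \oo,
     m0 <= delta_min (gram (X n)) /\
     delta_min (gram (X n)) <= delta_max (gram (X n)) /\
     delta_max (gram (X n)) <= M0)
  (* (A4), and the implicit condition on the sizes of the groups *)
  (c : R) (hc : 0 <= c < 2^-1)
  (hA4 : (fun n : nat => (p n)%:R : R^o) =O_\oo (fun n : nat => n%:R `^ c : R^o))
  (hr : (fun n : nat => (\sum_(j < p n) d n j)%:R : R^o) =O_\oo
        (fun n : nat => n%:R `^ c : R^o))
  (* (A5) *)
  (K alpha : R) (hK : 0 < K) (halpha : (c - 1) / 2 < alpha)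
  (hA5 : \forall n \near \oo,
     (K%:E <= (n%:R `^ (- alpha))%:E * min_signal (p0 n) (beta0 n))%E)
  (* tuning parameter *)
  (hlambda0 : lambda n @[n --> \oo] --> (0 : R))
  (hlambda1 :
     lambda n * n%:R `^ (2^-1 - alpha * gamma) @[n --> \oo] --> (0 : R))
  (hlambda2 :
     lambda n * n%:R `^ ((1 - c) * (1 + gamma) / 2) @[n --> \oo] --> +oo) :
  P [set w : T | active (betah n w) = active (beta0 n)] @[n --> \oo] --> 1%E.
Proof.
pose kappa := Num.min tau (1 - tau).
have [hk hk'] : kappa <= tau /\ kappa <= 1 - tau by rewrite !ge_min !lexx orbT.
have kappa0 : 0 < kappa by case/andP: htau => t0 t1; rewrite lt_min t0 subr_gt0.
have [v v0 Hv] := score_second_moment htau hindep hident hexpectile hmoment.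
have [Cp Cp0 hCp] := bigO_powR_near hA4.
have [Cr Cr0 hCr] := bigO_powR_near hr.
have key (e : R) : 0 < e -> \forall n \near \oo,
    measurable [set w | active (betah n w) = active (beta0 n)] /\
    ((1 - e)%:E <= P [set w | active (betah n w) = active (beta0 n)])%E.
  move=> e0.
  have A0 : 0 <= v * Cr * C0 ^+ 2 by rewrite mulr_ge0 ?sqr_ge0// mulr_ge0// ltW.
  have A1 : 0 < (v * Cr * C0 ^+ 2 + 1) / e by rewrite divr_gt0// ltr_wpDl.
  (* [v * Cr * C0 ^+ 2] bounds the second moment of the score divided by [n] to the power [1 + c];
     adding [1] keeps [M] positive when [v = 0]. *)
  pose M := Num.sqrt ((v * Cr * C0 ^+ 2 + 1) / e).
  have M2 : e * M ^+ 2 = v * Cr * C0 ^+ 2 + 1.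
    by rewrite sqr_sqrtr ?(ltW A1)// mulrC divfK ?gt_eqF.
  have Mgt0 : 0 < M by rewrite sqrtr_gt0.
  pose a := M / (kappa * m0).
  have a0 : 0 < a by rewrite divr_gt0// mulr_gt0.
  pose L1 := (K / 2) `^ (- gamma) * Num.sqrt Cp.
  have L10 : 0 < L1 by rewrite mulr_gt0 ?powR_gt0 ?divr_gt0 ?sqrtr_gt0.
  have near1 : \forall n \near \oo, lambda n * n%:R `^ (2^-1 - alpha * gamma) < M / L1.
    by apply: (cvgr_lt _ hlambda1); rewrite divr_gt0.
  have near2 : \forall n \near \oo, (M + 4 * M0 * a) / a `^ (- gamma) <
      lambda n * n%:R `^ ((1 - c) * (1 + gamma) / 2).
    by move/cvgryPgt : hlambda2; apply.
  have near3 : \forall n \near \oo, 2 * a / K + 1 <= n%:R `^ (alpha - (c - 1) / 2).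
    by apply: powR_ge_near; rewrite subr_gt0.
  near=> n.
  have n0 : (0 < n)%N by near: n; exact: nbhs_infty_gt.
  have x0 : 0 < n%:R :> R by rewrite ltr0n.
  have [r1 r2 r3 r4] := rates c alpha gamma x0 hK a0.
  set rho := n%:R `^ ((c - 1) / 2) in r1 r2 r3 r4.
  have rho0 : 0 < rho by rewrite powR_gt0.
  have hX : forall i : 'I_n, mx_norm (X n i) <= C0 by near: n.
  have hG : m0 <= delta_min (gram (X n)) /\
    delta_min (gram (X n)) <= delta_max (gram (X n)) /\ delta_max (gram (X n)) <= M0.
    by near: n.
  have hrn : (\sum_(j < p n) d n j)%:R <= Cr * n%:R `^ c by near: n.
  have hpn : (p n)%:R <= Cp * n%:R `^ c by near: n.
  have hsig : (K%:E <= (n%:R `^ (- alpha))%:E * min_signal (p0 n) (beta0 n))%E by near: n.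
  have h1 : lambda n * n%:R `^ (2^-1 - alpha * gamma) < M / L1 by near: n.
  have h2 : (M + 4 * M0 * a) / a `^ (- gamma) <
    lambda n * n%:R `^ ((1 - c) * (1 + gamma) / 2) by near: n.
  have h3 : 2 * a / K + 1 <= n%:R `^ (alpha - (c - 1) / 2) by near: n.
  (* In dimension zero there are no eigenvalues and [inf] of the empty set is [0], against
     [m0 <= delta_min]. *)
  have k0 : (0 < \sum_(j < p n) d n j)%N.
    rewrite lt0n; apply: contraL hm0 => /eqP k0; rewrite -leNgt.
    apply: le_trans hG.1 _; rewrite /delta_min.
    rewrite (_ : [set a | _] = set0) ?inf0//.
    apply/seteqP; split => // x /= /eigenvalueP[u _ /negP]; apply; apply/eqP/rowP => i.
    by suff : (i < 0)%N by []; apply: leq_trans (ltn_ord i) _; rewrite k0.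
  have [mS intS] := Hv _ _ _ (X n) (beta0 n).
  apply: (selection_probability (kappa := kappa) (m0 := m0) (M0 := M0)
    (s := M * rho) (t := a * rho) (eta := K * n%:R `^ alpha) htau hk hk' n0 kappa0
    (ltW hgamma) (hlambda n) hm0 _ _ _ _ _ _ _ _ _ (hbetat n) (hbetah n) mS).
  - by rewrite mulr_gt0.
  - move=> h; rewrite dot_gram// (mulrC m0) -mulrA ler_pM2l//.
    apply: le_trans (delta_min_rayleigh _ k0 (tr_gram _)).
    by rewrite ler_wpM2r ?sqr_ge0// hG.1.
  - move=> h; rewrite dot_gram// (mulrC M0) -mulrA ler_pM2l//.
    apply: le_trans (delta_max_rayleigh _ k0 (tr_gram _)) _.
    by rewrite ler_wpM2r ?sqr_ge0// hG.2.2.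
  - move=> j /hbeta0; apply: min_signal_le; first by rewrite powR_gt0.
    by rewrite -powRN.
  - by rewrite /a mulrAC.
  (* Signal against error: after cancelling [rho], a positive power of [n] must exceed [2 * a / K];
     positivity is [halpha]. *)
  - rewrite r2 (mulrA 2) (mulrA K) ltr_pM2r// -ltr_pdivrMl//.
    by rewrite mulrC (lt_le_trans _ h3)// ltrDl.
  - have sp : Num.sqrt (p n)%:R <= Num.sqrt Cp * n%:R `^ (c / 2).
      rewrite -(@powR12_sqrt _ (p n)%:R)// -(@powR12_sqrt _ Cp) ?(ltW Cp0)//.
      rewrite powRrM -powRM ?powR_ge0 ?(ltW Cp0)//.
      by apply: ge0_ler_powR; rewrite ?nnegrE ?mulr_ge0 ?powR_ge0 ?invr_ge0 ?(ltW Cp0).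
    apply: le_trans (ler_wpM2l _ sp) _.
      by rewrite mulr_ge0 ?powR_ge0 ?(ltW (hlambda n)).
    move: r3 h1; set x1 := _ `^ (- gamma); set x2 := _ `^ (c / 2).
    set x3 := _ `^ (2^-1 - _).
    move=> r3 h1; have -> : lambda n * x1 * (Num.sqrt Cp * x2) = lambda n * x3 * L1 * rho.
      transitivity (lambda n * Num.sqrt Cp * (x1 * x2)); first by ring.
      by rewrite r3 /L1; ring.
    by rewrite ler_pM2r// -ler_pdivlMr// ltW.
  - rewrite r4; move: h2; set x4 := _ `^ ((1 - c) * _ / 2); set x5 := a `^ _ => h2.
    have -> : M * rho + 4 * M0 * (a * rho) = (M + 4 * M0 * a) * rho by ring.
    have -> : lambda n * (x5 * (x4 * rho)) = lambda n * x4 * x5 * rho by ring.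
    by rewrite ltr_pM2r// -ltr_pdivrMr ?powR_gt0.
  - by move=> i; apply: measurable_funD.
  (* Each row has squared norm at most [C0 ^+ 2] times the total dimension, itself at most [Cr]
     times [n] to the power [c]; the choice of [M] absorbs the constants. *)
  - rewrite intS lee_fin (mulrCA n%:R) exprMn r1 (mulrA e) M2 mulrDl mul1r.
    apply: (@le_trans _ _ (v * (n%:R * (Cr * n%:R `^ c * C0 ^+ 2)))).
      rewrite ler_wpM2l// (_ : n%:R * _ = \sum_(i < n) (Cr * n%:R `^ c * C0 ^+ 2)).
        apply: ler_sum => i _; apply: le_trans (norm2_le_mx_norm (hX i)) _.
        by rewrite ler_wpM2r ?sqr_ge0.
      by rewrite sumr_const card_ord mulr_natl.
    rewrite -[leLHS]addr0 lerD ?mulr_ge0 ?powR_ge0//.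
    by rewrite le_eqVlt; apply/orP; left; apply/eqP; ring.
apply/fine_cvgP; split.
  by apply: filterS (key 1 ltr01) => n [mE _]; rewrite fin_num_measure.
apply/cvgrPdist_le => e e0; apply: filterS (key e e0) => n [mE] /=.
have := probability_le1 P mE.
rewrite -[P _]fineK ?fin_num_measure// !lee_fin => P1 Pe.
by rewrite ger0_norm ?subr_ge0// lerBlDr -lerBlDl.
Unshelve. all: by end_near. Qed.
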